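(* Consider an instance of online bipartite matching with homogeneous groups under the long-run fairness objective, and let $(x^*,s^* )$ with $s^*>0$ be the optimal solution of the benchmark LP used by the algorithm SAMP$(s^* )$. Let $b_{\min}=\min_{i\in I}b_i$ and define, for integers $b\ge1$ and reals $s>0$, $$g(b,s)=\max\{s,1\}\cdot\frac{\mathbb E[\min\{\mathrm{Pois}(b/s),b\}]}{b},$$ where $\mathrm{Pois}(\mu)$ denotes a Poisson random variable with mean $\mu$. Then the competitiveness of SAMP$(s^* )$ on this instance is at least $g(b_{\min},s^* )$, i.e. its long-run fairness is at least $g(b_{\min},s^* )$ times the long-run fairness of the optimal clairvoyant algorithm. Moreover: (i) $g(b,s)\ge g(1,1)=1-1/e$ for all integers $b\ge1$ and $s>0$; (ii) for any fixed $s>0$, $g(b,s)$ is minimized over integers $b\ge1$ at $b=1$, and $\lim_{b\to\infty}g(b,s)=1$; (iii) for any fixed integer $b>1$, $g(b,s)$ is minimized over $s>0$ at $s=1$, and $\lim_{s\to0^+}g(b,s)=\lim_{s\to\infty}g(b,s)=1$.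
   Context: Model: $I$ is a finite set of offline agents, $J$ a finite set of online types, $E\subseteq I\times J$ the eligible pairs; $\mathcal N_i=\{j:(i,j)\in E\}$, $\mathcal N_j=\{i:(i,j)\in E\}$. Offline agent $i$ has integer capacity $b_i\ge1$. Online agents of type $j$ arrive by independent Poisson processes of constant rate $\lambda_j>0$ on $[0,1]$; on each arrival the type is revealed and an online algorithm must immediately and irrevocably serve it with some $i\in\mathcal N_j$ with remaining capacity, or reject it. A clairvoyant algorithm knows the realized arrivals in advance and assigns (possibly randomly) subject to the same constraints. Homogeneous groups: each protected group is a single type (one per type), and the long-run fairness of an algorithm is $\min_{j\in J}\mathbb E[X_j]/\lambda_j$, where $X_j$ is the number of type-$j$ agents served. Competitiveness of an algorithm on an instance is the ratio of its objective value to that of the optimal clairvoyant algorithm (at most 1). Benchmark LP: maximize $s$ subject to $\sum_{j\in\mathcal N_i}x_{ij}\le b_i$ for all $i\in I$, $\sum_{i\in\mathcal N_j}x_{ij}\ge s\lambda_j$ for all $j\in J$, and $s\ge0$, $x_{ij}\ge0$ for $(i,j)\in E$. Algorithm SAMP$(s^* )$: compute an optimal LP solution $(x^*,s^* )$ and, for each $j$, rescale $x^*_{ij}$ ($i\in\mathcal N_j$) by the factor $s^*\lambda_j/\sum_{i\in\mathcal N_j}x^*_{ij}$ so that $\sum_{i\in\mathcal N_j}x^*_{ij}=s^*\lambda_j$ (this keeps feasibility and optimality). When an agent of type $j$ arrives, sample one $i\in\mathcal N_j$ with probability $x^*_{ij}/(s^*\lambda_j)$; if $i$ has not reached its capacity,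 serve the agent with $i$, otherwise reject it (no re-sampling). *)

(* Defs.v *)
From HB Require Import structures.
From mathcomp Require Import all_boot all_order all_algebra.
From mathcomp Require Import all_classical all_reals all_analysis.

Set Implicit Arguments.
Unset Strict Implicit.
Unset Printing Implicit Defensive.

Import Order.TTheory GRing.Theory Num.Theory.
Import numFieldNormedType.Exports.

Local Open Scope classical_set_scope.
Local Open Scope ring_scope.

Section independence.
Context {d : measure_display} {Omega : measurableType d} {R : realType}.
Variable P : probability Omega R.

(* The events {X \in B}, for X with values in a countable discrete space. *)
Definition sigma_rv {T : Type} (X : Omega -> T) : set (set Omega) :=
  preimage_set_system setT X setT.

Definition discrete_rv {T : Type} (X : Omega -> T) : Prop :=
  sigma_rv X `<=` measurable.

Definition mutually_independent {K : eqType} (F : K -> set (set Omega)) : Prop :=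
  forall (r : seq K) (A : K -> set Omega), uniq r ->
    (forall k, k \in r -> F k (A k)) ->
    P (\bigcap_(k in [set` r]) A k) = (\prod_(k <- r) P (A k))%E.

End independence.

Section poisson_process.
Context {d : measure_display} {Omega : measurableType d} {R : realType}.
Variable P : probability Omega R.

(* [N t w] is the number of arrivals in [0, t]; only t in [0, 1] matters.
   The second argument of [poisson_prob] is a dummy. *)
Definition is_poisson_process (rate : R) (N : R -> Omega -> nat) : Prop :=
  [/\ forall t, 0 <= t <= 1 -> discrete_rv (N t),
      forall w,
        [/\ N 0 w = 0%N,
            forall u t, 0 <= u -> u <= t -> t <= 1 -> (N u w <= N t w)%N &
            forall t, 0 <= t < 1 -> \forall u \near t^'+, N u w = N t w],
      forall u t, 0 <= u -> u < t -> t <= 1 -> forall A : set nat,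
        P [set w | A (N t w - N u w)%N] = poisson_prob (rate * (t - u)) 0%N A &
      forall t : nat -> R, {homo t : m n / (m <= n)%N >-> m <= n} ->
        (forall n, 0 <= t n <= 1) ->
        mutually_independent P
          (fun n => sigma_rv (fun w => (N (t n.+1) w - N (t n) w)%N))].

Definition sigma_process (N : R -> Omega -> nat) : set (set Omega) :=
  <<s \bigcup_(t in `[0, 1]) sigma_rv (N t) >>.

End poisson_process.

Section matching.
Context {R : realType} {I J : finType}.
Variables (E : I -> J -> bool) (b : I -> nat) (lam : J -> R).

(* [\max_i b i] is neutral for the minimum when I is nonempty. *)
Definition bmin : nat := \big[minn/(\max_(i : I) b i)%N]_(i : I) b i.

Definition lp_feasible (x : I -> J -> R) (s : R) : Prop :=
  [/\ forall i, \sum_(j | E i j) x i j <= (b i)%:R,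
      forall j, s * lam j <= \sum_(i | E i j) x i j,
      0 <= s &
      forall i j, E i j -> 0 <= x i j].

Definition lp_optimal (x : I -> J -> R) (s : R) : Prop :=
  lp_feasible x s /\ forall x' s', lp_feasible x' s' -> s' <= s.

Definition rescale (x : I -> J -> R) (s : R) (i : I) (j : J) : R :=
  x i j * (s * lam j / \sum_(i' | E i' j) x i' j).

(* (j, k) stands for the (k+1)-st online agent of type j. *)
Definition agent : Type := (J * nat)%type.

(* A realization [n] of the arrivals: [n j t] is the number of type-j agents
   that arrive in [0, t]. *)
Definition arrival_time (n : J -> R -> nat) (a : agent) : R :=
  inf [set t | 0 <= t <= 1 /\ (a.2 < n a.1 t)%N].

(* The agents that arrive in [0, 1], in chronological order. Ties, which have
   probability zero, are broken by the enumeration of J. *)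
Definition arrivals (n : J -> R -> nat) : seq agent :=
  sort (fun a a' => arrival_time n a <= arrival_time n a')
    [seq (j, k) | j <- enum J, k <- iota 0 (n j 1)].

(* An assignment maps each agent to the offline agent that serves it, or to
   [None] if it is rejected or does not arrive. *)
Definition assignment : Type := agent -> option I.

Definition valid_assignment (n : J -> R -> nat) (m : assignment) : Prop :=
  (forall a i, m a = Some i -> (a.2 < n a.1 1%R)%N /\ E i a.1) /\
  (forall i, (count (fun a => m a == Some i) (arrivals n) <= b i)%N).

Definition served (n : J -> R -> nat) (m : assignment) (j : J) : nat :=
  count (fun a => (a.1 == j) && isSome (m a)) (arrivals n).

(* [sel a] is the offline agent sampled upon the arrival of [a]; the state is
   the remaining capacities and the assignment built so far. *)
Definition samp_step (sel : agent -> I) (st : (I -> nat) * assignment)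
    (a : agent) : (I -> nat) * assignment :=
  let: (c, m) := st in
  if (0 < c (sel a))%N
  then (fun i => if i == sel a then (c i).-1 else c i,
        fun a' => if a' == a then Some (sel a) else m a')
  else (c, m).

Definition samp (n : J -> R -> nat) (sel : agent -> I) : assignment :=
  (foldl (samp_step sel) (b, fun=> None) (arrivals n)).2.

Section stochastic.
Context {d : measure_display} {Omega : measurableType d}.
Variable P : probability Omega R.

Definition realization (N : J -> R -> Omega -> nat) (w : Omega)
  : J -> R -> nat := fun j t => N j t w.

Definition poisson_arrivals (N : J -> R -> Omega -> nat) : Prop :=
  (forall j, is_poisson_process P (lam j) (N j)) /\
  mutually_independent P (fun j => sigma_process (N j)).

Definition sigma_arrivals (N : J -> R -> Omega -> nat) : set (set Omega) :=
  <<s \bigcup_(j in [set: J]) sigma_process (N j) >>.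

(* [S a] is the sample drawn if agent [a] arrives. All the samples and the
   whole arrival process, which has index [None], are mutually independent. *)
Definition samp_samples (x : I -> J -> R) (s : R)
    (N : J -> R -> Omega -> nat) (S : agent -> Omega -> I) : Prop :=
  [/\ forall a, discrete_rv (S a),
      forall a i, E i a.1 ->
        P [set w | S a w = i] = (rescale x s i a.1 / (s * lam a.1))%:E &
      mutually_independent P (fun o : option (J * nat) =>
        if o is Some a then sigma_rv (S a) else sigma_arrivals N)].

Definition long_run_fairness (N : J -> R -> Omega -> nat)
    (M : Omega -> assignment) : \bar R :=
  (\big[Order.min/+oo]_(j : J)
     ('E_P[fun w => (served (realization N w) (M w) j)%:R] / (lam j)%:E))%E.

Definition samp_algorithm (N : J -> R -> Omega -> nat)
    (S : agent -> Omega -> I) : Omega -> assignment :=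
  fun w => samp (realization N w) (fun a => S a w).

(* The assignment may be any random element defined jointly with the whole
   arrival process, i.e., any randomized function of it. *)
Definition clairvoyant (N : J -> R -> Omega -> nat) (M : Omega -> assignment)
  : Prop :=
  (forall a, discrete_rv (fun w => M w a)) /\
  (forall w, valid_assignment (realization N w) (M w)).

End stochastic.

(* The supremum is over all probability spaces that carry the arrival process,
   so that the randomization of the algorithm is unrestricted. *)
Definition clairvoyant_optimum : \bar R :=
  ereal_sup [set v | exists (d : measure_display) (Omega : measurableType d)
    (P : probability Omega R) (N : J -> R -> Omega -> nat)
    (M : Omega -> assignment),
    [/\ poisson_arrivals P N, clairvoyant N M & v = long_run_fairness P N M]].

Definition competitiveness {d : measure_display} {Omega : measurableType d}
    (P : probability Omega R) (N : J -> R -> Omega -> nat)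
    (M : Omega -> assignment) : \bar R :=
  (long_run_fairness P N M / clairvoyant_optimum)%E.

End matching.

Definition g {R : realType} (b : nat) (s : R) : R :=
  Num.max s 1 *
  (fine 'E_(poisson_prob (b%:R / s) 0%N)[fun k : nat => (minn k b)%:R] / b%:R).

(* Main.v *)
(* The expected numbers of type-j agents that a clairvoyant algorithm serves
   with i are LP-feasible, and an algorithm serves at most the agents that
   arrive, so the clairvoyant optimum is at most min(s, 1).

   For SAMP, cut [0, 1] into n intervals of length h. A type-j agent that
   arrives in (u, u + h] and samples i is certainly served if i receives at most
   b_i requests by time u + h. By thinning and superposition, the requests to i
   are Poisson of some rate mu_i <= b_i / s, and those of type j among them of
   some rate nu_ij. The identity E[U; U + V <= b] = E[U] P(U + V < b) for
   independent Poisson variables U and V shows that i serves on average at least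
   nu_ij h sum_(l < n) P(Pois(mu_i (l + 1) h) < b_i) agents of type j. Since
   d/dm E[min(Pois(m), b)] = P(Pois(m) < b), this Riemann sum tends to a limit
   bounded below by nu_ij E[min(Pois(b_i / s), b_i)] / (b_i / s). The law of
   the requests is obtained from finite truncations: the generating polynomials
   of thinned truncated Poisson laws converge coefficientwise.

   The shape of g follows from the concavity of m |-> E[min(Pois(m), b)] (in s)
   and from Jensen's inequality for binomial thinning (in b). *)

From HB Require Import structures.
Require Import Defs.
From mathcomp Require Import all_boot all_order all_algebra.
From mathcomp Require Import all_classical all_reals all_analysis.
From mathcomp Require Import measurable_realfun ring lra zify.

Set Implicit Arguments.
Unset Strict Implicit.
Unset Printing Implicit Defensive.

Import Order.TTheory GRing.Theory Num.Theory.
Import numFieldNormedType.Exports.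

Local Open Scope classical_set_scope.
Local Open Scope ring_scope.

(** * Poisson weights *)

Section poisson_weights.
Context {R : realType}.
Implicit Types (m p q x : R) (b k n : nat).

Definition pois m k : R := expR (- m) * (m ^+ k / k`!%:R).

(** The bound is strict: this is P(X < b), so [pois_cdf k.+1] is P(X <= k). *)
Definition pois_cdf b m : R := \sum_(k < b) pois m k.

(* [pois_deficit] and [pois_min] are the expectations of [(b - X)^+] and of
   [min X b] for X Poisson of mean m. *)
Definition pois_deficit b m : R := \sum_(k < b) pois_cdf k.+1 m.

Definition pois_min b m : R := b%:R - pois_deficit b m.

Lemma pois_ge0 m k : 0 <= m -> 0 <= pois m k.
Proof.
by move=> m0; rewrite mulr_ge0 ?expR_ge0// divr_ge0 ?exprn_ge0.
Qed.

Lemma pois0 k : pois 0 k = (k == 0%N)%:R.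
Proof.
rewrite /pois oppr0 expR0 mul1r expr0n.
by case: k => [|k] /=; rewrite ?mul0r// fact0 divr1.
Qed.

(** Size biasing: k P(X = k) = m P(X = k - 1). It drives the telescoping on the diagonal and the
    biased thinning below. *)
Lemma poisS m k : k.+1%:R * pois m k.+1 = m * pois m k.
Proof.
rewrite /pois factS natrM exprS.
field.
by rewrite nat1r !pnatr_eq0 -lt0n fact_gt0.
Qed.

Lemma pois_cdf_ge0 b m : 0 <= m -> 0 <= pois_cdf b m.
Proof. by move=> m0; apply: sumr_ge0 => k _; exact: pois_ge0. Qed.

Lemma sum_exp_coeff_le x n : 0 <= x -> \sum_(k < n) x ^+ k / k`!%:R <= expR x.
Proof.
move=> x0.
have /nondecreasing_cvgn_le := @nondecreasing_series _ (exp_coeff x) xpredT 0%N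
  (fun n _ _ => exp_coeff_ge0 n x0).
move=> /(_ (is_cvg_series_exp_coeff x) n).
by rewrite /series /= big_mkord.
Qed.

Lemma pois_cdf_le1 b m : 0 <= m -> pois_cdf b m <= 1.
Proof.
move=> m0; rewrite /pois_cdf -mulr_sumr -[leRHS](expRxMexpNx_1 (- m)) opprK.
by rewrite ler_pM2l ?expR_gt0// sum_exp_coeff_le.
Qed.

Lemma pois_cdf_ge_exp b m : (0 < b)%N -> 0 <= m -> expR (- m) <= pois_cdf b m.
Proof.
case: b => // b _ m0; rewrite /pois_cdf big_ord_recl /= {1}/pois.
rewrite expr0 fact0 divr1 mulr1 lerDl.
by apply: sumr_ge0 => k _; exact: pois_ge0.
Qed.

(** (b - X)^+ counts the k < b with X <= k: the definition sums over these thresholds, this form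
    over the values of X. *)
Lemma pois_deficitE b m :
  pois_deficit b m = \sum_(k < b) (b%:R - k%:R) * pois m k.
Proof.
elim: b => [|b IH]; first by rewrite /pois_deficit !big_ord0.
rewrite /pois_deficit big_ord_recr /= -/(pois_deficit b m) IH.
rewrite /pois_cdf [in RHS]big_ord_recr [X in _ + X = _]big_ord_recr /=.
rewrite addrA -big_split /=; congr (_ + _); last first.
  by rewrite -natr1 addrAC subrr add0r mul1r.
by apply: eq_bigr => k _; rewrite -natr1; ring.
Qed.

(** The derivative of [pois m k.+1] is [pois m k - pois m k.+1], so the sum telescopes to its last
    term. *)
Lemma is_derive_pois_cdf k m :
  is_derive m (1 : R) (pois_cdf k.+1) (- pois m k).
Proof.
elim: k => [|k IH].
  rewrite (_ : pois_cdf 1 = expR \o -%R); last first.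
    by apply/funext => x; rewrite /pois_cdf big_ord1 /pois expr0 fact0 divr1 mulr1.
  apply: is_derive_eq.
  by rewrite /pois expr0 fact0 divr1 mulr1 /GRing.scale/= mulrN1.
rewrite (_ : pois_cdf k.+2 = pois_cdf k.+1 \+ (pois ^~ k.+1)); last first.
  by apply/funext => x; rewrite /pois_cdf big_ord_recr.
have -> : - pois m k.+1 = - pois m k + (pois m k - pois m k.+1) by ring.
apply: is_deriveD.
have dX : is_derive m (1 : R) (fun x => x ^+ k.+1) (k.+1%:R * m ^+ k).
  apply: DeriveDef; first exact: exprn_derivable.
  by rewrite exp_derive /GRing.scale /= mulr1.
rewrite (_ : pois ^~ k.+1 =
  (expR \o -%R) \* ((fun x => x ^+ k.+1) \* cst (k.+1`!%:R)^-1)); last by [].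
apply: is_derive_eq.
rewrite /pois /GRing.scale /= factS natrM exprS.
field.
by rewrite nat1r !pnatr_eq0 -lt0n fact_gt0.
Qed.

(** Raising the cap from b to b + 1 adds P(X > b), whose derivative is the weight at b; these
    weights add up to P(X < b). *)
Lemma is_derive_pois_min b m :
  is_derive m (1 : R) (pois_min b) (pois_cdf b m).
Proof.
elim: b => [|b IH].
  rewrite (_ : pois_min 0 = cst 0); last first.
    by apply/funext => x; rewrite /pois_min /pois_deficit big_ord0 subr0.
  by apply: is_derive_eq; rewrite /pois_cdf big_ord0.
rewrite (_ : pois_min b.+1 = pois_min b \+ (cst 1 \- pois_cdf b.+1)); last first.
  apply/funext => x; rewrite /pois_min /pois_deficit big_ord_recr /= -natr1; ring.
have D := is_derive_pois_cdf b m.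
by apply: is_derive_eq; rewrite /pois_cdf big_ord_recr /= sub0r opprK.
Qed.

Lemma continuous_pois_min b : continuous (pois_min b).
Proof.
move=> m; apply: differentiable_continuous; apply/derivable1_diffP.
by have [] := is_derive_pois_min b m.
Qed.

Lemma continuous_pois_cdf k : continuous (pois_cdf k.+1).
Proof.
move=> m; apply: differentiable_continuous; apply/derivable1_diffP.
by have [] := is_derive_pois_cdf k m.
Qed.

Lemma pois_cdf_nincr b m m' : 0 <= m -> m <= m' -> pois_cdf b m' <= pois_cdf b m.
Proof.
case: b => [|b] m0 mm'; first by rewrite /pois_cdf !big_ord0.
have [c /andP[/=]] := MVT_segment mm'
  (fun x _ => is_derive_pois_cdf b x)
  (continuous_subspaceT (@continuous_pois_cdf b)).
rewrite bnd_simp => mc _ /eqP; rewrite subr_eq => /eqP ->.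
by rewrite gerDr mulNr oppr_le0 mulr_ge0 ?subr_ge0 ?pois_ge0// (le_trans m0).
Qed.

(** Concavity in the mean, from the mean value theorem and the decrease of the slope P(X < b). Most
    bounds on [pois_min] below are instances of it. *)
Lemma pois_min_tangent b m m' : 0 <= m -> 0 <= m' ->
  pois_min b m' <= pois_min b m + (m' - m) * pois_cdf b m.
Proof.
move=> m0 m'0; have [mm'|m'm] := leP m m'.
- have [c] := MVT_segment mm'
    (fun x _ => is_derive_pois_min b x)
    (continuous_subspaceT (@continuous_pois_min b)).
  rewrite in_itv /= => /andP[mc _] /eqP; rewrite subr_eq => /eqP ->.
  rewrite addrC lerD2l mulrC ler_wpM2l ?subr_ge0//.
  exact: pois_cdf_nincr.
- have [c] := MVT_segment (ltW m'm)
    (fun x _ => is_derive_pois_min b x)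
    (continuous_subspaceT (@continuous_pois_min b)).
  rewrite in_itv /= => /andP[mc cm] e.
  have := @pois_cdf_nincr b c m (le_trans m'0 mc) cm.
  move: e m'm; nra.
Qed.

Lemma pois_min0 b : pois_min b 0 = 0.
Proof.
apply/eqP; rewrite /pois_min subr_eq0 /pois_deficit eq_sym.
rewrite (eq_bigr (fun=> 1)) ?sumr_const ?card_ord//.
move=> k _; rewrite /pois_cdf big_ord_recl /= pois0 big1 ?addr0// => i _.
by rewrite pois0.
Qed.

Lemma pois_min_ge b m : 0 <= m -> m * pois_cdf b m <= pois_min b m.
Proof.
move=> m0; have := pois_min_tangent b m0 (lexx 0).
by rewrite pois_min0 sub0r mulNr subr_ge0.
Qed.

Lemma pois_min_le_mean b m : 0 <= m -> pois_min b m <= m.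
Proof.
move=> m0; have := pois_min_tangent b (lexx 0) m0.
rewrite pois_min0 add0r subr0 => /le_trans; apply.
by rewrite ler_piMr// pois_cdf_le1.
Qed.

Lemma pois_min_le b m : 0 <= m -> pois_min b m <= b%:R.
Proof.
move=> m0; rewrite /pois_min gerBl; apply: sumr_ge0 => k _.
exact: pois_cdf_ge0.
Qed.

Lemma pois_min_gt0 b m : (0 < b)%N -> 0 < m -> 0 < pois_min b m.
Proof.
move=> b0 m0; apply: lt_le_trans (pois_min_ge b (ltW m0)).
rewrite mulr_gt0//.
exact: lt_le_trans (expR_gt0 _) (pois_cdf_ge_exp b0 (ltW m0)).
Qed.

Lemma pois_min_ndecr b m m' : 0 <= m -> m <= m' -> pois_min b m <= pois_min b m'.
Proof.
move=> m0 mm'.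
have m'0 := le_trans m0 mm'.
have := pois_min_tangent b m'0 m0.
move=> /le_trans; apply; rewrite gerDl mulr_le0_ge0 ?pois_cdf_ge0//.
by rewrite subr_le0.
Qed.

(** A concave function vanishing at 0 has chords from the origin of decreasing slope. *)
Lemma pois_min_ratio b m m' : 0 < m -> m <= m' ->
  pois_min b m' / m' <= pois_min b m / m.
Proof.
move=> m0 mm'; have m'0 := lt_le_trans m0 mm'.
rewrite ler_pdivrMr// mulrAC ler_pdivlMr//.
have := pois_min_tangent b (ltW m0) (ltW m'0).
have := pois_min_ge b (ltW m0).
move: m0 mm'; nra.
Qed.

Lemma binomial_sum n p : \sum_(k < n.+1) 'C(n, k)%:R * (p ^+ k * (1 - p) ^+ (n - k)) = 1.
Proof.
have := exprDn (1 - p) p n; rewrite subrK expr1n => h; rewrite [RHS]h.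
by apply: eq_bigr => k _; rewrite -[in RHS]mulr_natl [p ^+ _ * _]mulrC.
Qed.

Lemma binomial_mean n p :
  \sum_(k < n.+1) k%:R * ('C(n, k)%:R * (p ^+ k * (1 - p) ^+ (n - k))) = n%:R * p.
Proof.
case: n => [|n]; first by rewrite big_ord1 !mul0r.
rewrite big_ord_recl /= mul0r add0r -[RHS]mulr1 -[X in _ = _ * X](binomial_sum n p) mulr_sumr.
apply: eq_bigr => k _; rewrite /bump /= add1n subSS mulrA -natrM.
by rewrite -mul_bin_diag natrM exprS; ring.
Qed.

(** Kept and discarded points decouple. The whole factor exp(-m) stays with the kept part; summing
    the discarded part over n contributes exp(m (1 - p)). *)
Lemma pois_thinning_term m p n k : (k <= n)%N ->
  pois m n * ('C(n, k)%:R * (p ^+ k * (1 - p) ^+ (n - k))) =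
  (expR (- m) * ((m * p) ^+ k / k`!%:R)) *
  ((m * (1 - p)) ^+ (n - k) / (n - k)`!%:R).
Proof.
move=> kn; rewrite /pois -(bin_fact kn) -{1}(subnK kn) !natrM exprD !exprMn.
field.
by rewrite !pnatr_eq0 -!lt0n !fact_gt0 bin_gt0.
Qed.

(** By the factorization the sum is a constant times a partial exponential series in m (1 - p); the
    full series would give the thinned weight. *)
Lemma pois_thinning_le m p n k : 0 <= m -> 0 <= p <= 1 ->
  \sum_(i < n | (k <= i)%N) pois m i * ('C(i, k)%:R * (p ^+ k * (1 - p) ^+ (i - k)))
  <= pois (m * p) k.
Proof.
move=> m0 /andP[p0 p1].
rewrite (eq_bigr (fun i : 'I_n => (expR (- m) * ((m * p) ^+ k / k`!%:R)) *
  ((m * (1 - p)) ^+ (i - k) / (i - k)`!%:R))); last first.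
  by move=> i ki; exact: pois_thinning_term.
rewrite -mulr_sumr.
rewrite (_ : pois (m * p) k = (expR (- m) * ((m * p) ^+ k / k`!%:R)) *
  expR (m * (1 - p))); last first.
  rewrite /pois mulrAC -expRD; congr (expR _ * _); ring.
rewrite ler_wpM2l ?mulr_ge0 ?expR_ge0 ?divr_ge0 ?exprn_ge0 ?mulr_ge0//.
rewrite (le_trans _ (@sum_exp_coeff_le _ (n - k) _)) ?mulr_ge0 ?subr_ge0//.
rewrite -(big_mkord (fun i => (k <= i)%N)
  (fun i => (m * (1 - p)) ^+ (i - k) / (i - k)`!%:R)).
rewrite -(big_mkord xpredT (fun i => (m * (1 - p)) ^+ i / i`!%:R)).
have [kn|nk] := leqP k n.
  rewrite (big_cat_nat _ kn)//= big_nat_cond big_pred0 ?add0r; last first.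
    by move=> i; apply/negP => /andP[/andP[_ ik]]; rewrite leqNgt ik.
  rewrite -{1}[k]add0n big_addn big_mkcond /=.
  apply: ler_sum => i _; rewrite addnK; case: ifP => // _.
  by rewrite divr_ge0 ?exprn_ge0 ?mulr_ge0 ?subr_ge0.
rewrite big_nat_cond big_pred0 ?sumr_ge0// => [i _|i].
  by rewrite divr_ge0 ?exprn_ge0 ?mulr_ge0 ?subr_ge0.
by apply/negP => /andP[/andP[_ iN]]; rewrite leqNgt (ltn_trans iN nk).
Qed.

(* A Poisson variable of mean m thinned with probability b/(b+1) is Poisson of
   mean m b/(b+1); condition on the unthinned variable and apply Jensen's
   inequality to [(b - x)^+]. *)
Lemma pois_deficit_thinning b m : 0 <= m ->
  b%:R / b.+1%:R * pois_deficit b.+1 m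
  <= pois_deficit b (m * (b%:R / b.+1%:R)).
Proof.
move=> m0; set p := b%:R / b.+1%:R.
have p01 : 0 <= p <= 1.
  by rewrite divr_ge0//= ler_pdivrMr ?ltr0n// mul1r ler_nat.
have /andP[p0 p1] := p01.
rewrite !pois_deficitE.
pose B (i k : nat) := 'C(i, k)%:R * (p ^+ k * (1 - p) ^+ (i - k)).
have B0 i k : 0 <= B i k by rewrite mulr_ge0// mulr_ge0 ?exprn_ge0 ?subr_ge0.
(* Only the values i <= b of the unthinned variable are retained; for the others (b + 1 - i)^+
   vanishes. *)
apply: (@le_trans _ _ (\sum_(k < b) (b%:R - k%:R) *
    \sum_(i < b.+1 | (k <= i)%N) pois m i * B i k)); last first.
  apply: ler_sum => k _; rewrite ler_wpM2l ?subr_ge0 ?ler_nat ?(ltnW (ltn_ord k))//.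
  exact: pois_thinning_le.
under [leRHS]eq_bigr do rewrite mulr_sumr.
rewrite (exchange_big_dep xpredT)//= mulr_sumr.
apply: ler_sum => i _.
(* The choice p = b / (b + 1) turns the left weight into b - i p, the mean of b - Bin(i, p). *)
have -> : p * ((b.+1%:R - i%:R) * pois m i) = (b%:R - i%:R * p) * pois m i.
  rewrite /p; field.
  by rewrite nat1r pnatr_eq0.
have -> : \sum_(k < b | (k <= i)%N) (b%:R - k%:R) * (pois m i * B i k) =
    (\sum_(k < b | (k <= i)%N) (b%:R - k%:R) * B i k) * pois m i.
  by rewrite mulr_suml; apply: eq_bigr => k _; rewrite mulrCA mulrC.
rewrite ler_wpM2r ?pois_ge0//.
rewrite -(binomial_mean i p) -[X in X - _]mulr1 -[X in _ * X - _](binomial_sum i p) mulr_sumr.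
rewrite -sumrB (eq_bigr (fun k : 'I_i.+1 => (b%:R - k%:R) * B i k)); last first.
  by move=> k _; rewrite mulrBl.
rewrite -(big_mkord xpredT (fun k => (b%:R - k%:R) * B i k)).
rewrite -(big_mkord (fun k => (k <= i)%N) (fun k => (b%:R - k%:R) * B i k)).
have ib : (i <= b)%N by rewrite -ltnS.
(* As i <= b, every k <= i lies below b, except k = b when i = b, where the factor b - k
   vanishes. *)
have [ib'|] := ltnP i b.
  rewrite [leRHS](big_cat_nat _ ib')//= [X in _ <= _ + X]big_nat_cond.
  rewrite [X in _ <= _ + X]big_pred0 ?addr0; last first.
    by move=> k; apply/negP => /andP[/andP[ik _]]; rewrite leqNgt ik.
  by rewrite big_nat [leRHS]big_nat_cond [leRHS]big_mkcondr /=;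
    apply: ler_sum => k; rewrite ltnS => ->.
move=> bi; have {bi ib}-> : (i : nat) = b by apply/eqP; rewrite eqn_leq ib bi.
rewrite big_nat_recr//= subrr mul0r addr0.
by rewrite big_nat [leRHS]big_nat_cond [leRHS]big_mkcondr /=;
  apply: ler_sum => k kb; rewrite ltnW.
Qed.

(** Induction on the capacity: thinning mean (c + 1) t by c / (c + 1) gives mean c t, so the deficit
    per unit of capacity does not grow from c to c + 1. *)
Lemma pois_min_avg_ndecr t b b' : 0 <= t -> (0 < b)%N -> (b <= b')%N ->
  pois_min b (b%:R * t) / b%:R <= pois_min b' (b'%:R * t) / b'%:R.
Proof.
move=> t0 b0 /subnKC <-; elim: (b' - b)%N => [|n]; first by rewrite addn0.
move=> /le_trans; apply; rewrite addnS.
set c := (b + n)%N; have c0 : (0 < c)%N by rewrite addn_gt0 b0.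
have cR : 0 < c%:R :> R by rewrite ltr0n.
have := @pois_deficit_thinning c (c.+1%:R * t) (mulr_ge0 (ler0n _ _) t0).
have -> : c.+1%:R * t * (c%:R / c.+1%:R) = c%:R * t.
  by field; rewrite nat1r pnatr_eq0.
rewrite /pois_min !mulrBl !divff ?pnatr_eq0 -?lt0n// lerD2l lerN2 => h.
by rewrite ler_pdivlMr// mulrC mulrA mulrAC.
Qed.

(** With mean b, (b - k) P(X = k) = (k + 1) P(X = k + 1) - k P(X = k), which telescopes up to any
    limit n. *)
Lemma pois_deficit_diag b : pois_deficit b b%:R = b%:R * pois b%:R b.
Proof.
rewrite pois_deficitE.
suff H n : \sum_(k < n) (b%:R - k%:R) * pois b%:R k = n%:R * pois b%:R n by [].
elim: n => [|n IH]; first by rewrite big_ord0 mul0r.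
by rewrite big_ord_recr /= IH poisS -mulrDl addrC subrK.
Qed.

Lemma pois_le_inv m k : 0 < m -> pois m k <= k.+1%:R / m.
Proof.
move=> m0; rewrite ler_pdivlMr// mulrC -poisS ler_piMr//.
have := @pois_cdf_le1 k.+2 m (ltW m0).
apply: le_trans; rewrite /pois_cdf big_ord_recr /= lerDr.
by apply: sumr_ge0 => i _; exact: pois_ge0 (ltW m0).
Qed.

(** Flatness to the right of the mode: from b + r to b + r + 1 the weight is multiplied by b / (b +
    r + 1), and the accumulated relative loss stays within r^2 / b. *)
Lemma pois_diag_ratio b r : (0 < b)%N ->
  (1 - r%:R ^+ 2 / b%:R) * pois b%:R b <= pois b%:R (b + r) :> R.
Proof.
move=> b0; have bR : 0 < b%:R :> R by rewrite ltr0n.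
have p0 k : 0 <= pois b%:R k :> R by exact: pois_ge0.
elim: r => [|r IH]; first by rewrite expr0n mul0r subr0 mul1r addn0.
have := poisS b%:R (b + r) => e.
rewrite addnS.
have c0 : 0 < (b + r).+1%:R :> R by rewrite ltr0n.
rewrite -(ler_pM2l c0) e -addnS natrD -natr1.
have := ler_wpM2l (ltW bR) IH; apply: le_trans.
rewrite [leLHS]mulrA [leRHS]mulrA ler_wpM2r//.
have r0 : 0 <= r%:R :> R by [].
have -> : (b%:R + (r%:R + 1)) * (1 - (r%:R + 1) ^+ 2 / b%:R) =
  b%:R + (r%:R + 1) - (r%:R + 1) ^+ 2 - (r%:R + 1) ^+ 3 / b%:R :> R.
  by field; rewrite gt_eqF.
have -> : b%:R * (1 - r%:R ^+ 2 / b%:R) = b%:R - r%:R ^+ 2 :> R.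
  by field; rewrite gt_eqF.
have : 0 <= (r%:R + 1) ^+ 3 / b%:R :> R.
  by rewrite divr_ge0// exprn_ge0// addr_ge0.
move: r0; nra.
Qed.

(** The n weights from b to b + n - 1 add up to at most 1, and 2 n^2 <= b makes each at least half
    of the weight at b. *)
Lemma pois_diag_le n b : (0 < n)%N -> (2 * n ^ 2 <= b)%N ->
  pois b%:R b <= 2 / n%:R :> R.
Proof.
move=> n0 nb; have b0 : (0 < b)%N.
  by apply: leq_trans nb; rewrite muln_gt0 expn_gt0 n0.
have bR : 0 < b%:R :> R by rewrite ltr0n.
rewrite ler_pdivlMr ?ltr0n//.
have : \sum_(r < n) pois b%:R (b + r) <= 1 :> R.
  apply: le_trans (@pois_cdf_le1 (b + n) b%:R (ltW bR)).
  rewrite /pois_cdf big_split_ord /= lerDr.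
  by apply: sumr_ge0 => i _; exact: pois_ge0 (ltW bR).
have : \sum_(r < n) 2^-1 * pois b%:R b <= \sum_(r < n) pois b%:R (b + r) :> R.
  apply: ler_sum => r _.
  apply: le_trans (pois_diag_ratio r b0).
  rewrite ler_wpM2r ?pois_ge0 ?(ltW bR)//.
  suff : r%:R ^+ 2 / b%:R <= 2^-1 :> R by lra.
  rewrite ler_pdivrMr// mulrC ler_pdivlMr// -natrX -natrM ler_nat.
  apply: leq_trans nb; rewrite mulnC leq_mul2l /= leq_exp2r//.
  exact: ltnW.
rewrite sumr_const card_ord -mulr_natr; lra.
Qed.

End poisson_weights.

(** * Expectations under the Poisson law *)

Section poisson_expectation.
Context {R : realType}.
Implicit Types (m : R) (b k n : nat).

Lemma poisson_prob_seq m (s : seq nat) : 0 < m -> uniq s ->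
  poisson_prob m 0 [set` s] = (\sum_(k <- s) pois m k)%:E.
Proof.
move=> m0 us; rewrite /poisson_prob m0 esum_fset//; first last.
- by move=> k _; rewrite lee_fin poisson_pmf_ge0.
- exact: finite_seq.
rewrite -fsbig_seq//= -sumEFin; apply: eq_bigr => k _.
by rewrite /poisson_pmf m0 /pois mulrC.
Qed.

Lemma poisson_prob1 m k : 0 < m -> poisson_prob m 0 [set k] = (pois m k)%:E.
Proof.
move=> m0; rewrite (_ : [set k] = [set` [:: k]]) ?poisson_prob_seq ?big_seq1//.
by apply/seteqP; split=> x /=; rewrite inE => /eqP.
Qed.

Lemma poisson_prob_gt m n : 0 < m ->
  poisson_prob m 0 [set k | (n < k)%N] = (1 - pois_cdf n.+1 m)%:E.
Proof.
move=> m0.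
rewrite (_ : [set k | _] = ~` [set` iota 0 n.+1]); last first.
  apply/seteqP; split=> k; rewrite /setC /mkset mem_iota add0n /= ltnS.
    by rewrite ltnNge => /negP.
  by move=> /negP; rewrite -ltnNge.
transitivity (1 - poisson_prob m 0 [set` iota 0 n.+1])%E.
  exact: (probability_setC (poisson_prob m 0)).
rewrite poisson_prob_seq ?iota_uniq// -EFinB.
by rewrite /pois_cdf -(big_mkord xpredT (pois m)) /index_iota subn0.
Qed.

Lemma measurable_discrete_rv d (Omega : measurableType d) T (X : Omega -> T)
    (A : set T) : discrete_rv X -> measurable [set w | A (X w)].
Proof.
move=> mX; apply: mX; exists A => //.
by rewrite setTI.
Qed.

Lemma minn_sum k b : minn k b = (\sum_(n < b) (n < k))%N.
Proof.
elim: b => [|b IH]; first by rewrite big_ord0 minn0.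
rewrite big_ord_recr /= -IH; lia.
Qed.

(** [minn X b] counts the thresholds n < b lying below X, which reduces the expectation to finitely
    many tail probabilities. *)
Lemma expectation_minn d (Omega : measurableType d) (P : probability Omega R)
    (X : Omega -> nat) b : discrete_rv X ->
  ('E_P[fun w => (minn (X w) b)%:R] =
  \sum_(n < b) P [set w | (n < X w)%N])%E.
Proof.
move=> mX; rewrite unlock.
have mlt n : measurable [set w | (n < X w)%N].
  exact: (measurable_discrete_rv (fun k => n < k)%N mX).
transitivity (\int[P]_w \sum_(n < b) (\1_[set w | (n < X w)%N] w)%:E)%E.
  apply: eq_integral => w _; rewrite sumEFin; congr EFin.
  under eq_bigr do rewrite indicE.
  rewrite -natr_sum minn_sum; congr _%:R.
  apply: eq_bigr => n _; congr nat_of_bool.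
  by apply/idP/idP => [h|]; [exact: mem_set|rewrite inE].
rewrite ge0_integral_sum//; last first.
  by move=> n; apply/measurable_EFinP; exact: measurable_indic.
by apply: eq_bigr => n _; rewrite integral_indic// setIT.
Qed.

Lemma expectation_minn_poisson d (Omega : measurableType d)
    (P : probability Omega R) (X : Omega -> nat) b m : discrete_rv X -> 0 < m ->
  (forall A, P [set w | A (X w)] = poisson_prob m 0 A) ->
  ('E_P[fun w => (minn (X w) b)%:R] = (pois_min b m)%:E)%E.
Proof.
move=> mX m0 lawX; rewrite expectation_minn//.
under eq_bigr => n _ do
  rewrite (lawX (fun k => n < k)%N) poisson_prob_gt//.
rewrite sumEFin; congr EFin.
by rewrite sumrB sumr_const card_ord.
Qed.

Lemma gE b (s : R) : (0 < b)%N -> 0 < s ->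
  g b s = Num.max s 1 * (pois_min b (b%:R / s) / b%:R).
Proof.
move=> b0 s0; rewrite /g (@expectation_minn_poisson _ _ _ id b (b%:R / s))//.
by rewrite divr_gt0// ltr0n.
Qed.

End poisson_expectation.

(** * The guarantee g *)

Section g_properties.
Context {R : realType}.
Implicit Types (s : R) (b : nat).

Lemma g_le1 b s : (0 < b)%N -> 0 < s -> s <= 1 ->
  g b s = pois_min b (b%:R / s) / b%:R.
Proof. by move=> b0 s0 s1; rewrite gE// max_r// mul1r. Qed.

(** For s >= 1 the factor s turns the normalization by b into one by the Poisson mean b / s. *)
Lemma g_ge1 b s : (0 < b)%N -> 1 <= s ->
  g b s = pois_min b (b%:R / s) / (b%:R / s).
Proof.
move=> b0 s1; rewrite gE ?(lt_le_trans ltr01)// max_l//.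
by rewrite invf_div mulrCA.
Qed.

(** For s <= 1 the mean b / s is at least b and [pois_min] grows with the mean; for s >= 1 it is at
    most b and the ratio of [pois_min] to the mean falls as the mean grows. *)
Lemma g_ge_g1 b s : (0 < b)%N -> 0 < s -> g b 1 <= g b s.
Proof.
move=> b0 s0; have b0R : 0 < b%:R :> R by rewrite ltr0n.
have [s1|/ltW s1] := leP s 1.
- rewrite !g_le1// ler_pM2r ?invr_gt0// pois_min_ndecr ?divr_ge0//.
  by rewrite ler_pM2l// lef_pV2 ?posrE.
- rewrite !g_ge1// pois_min_ratio ?divr_gt0//.
  by rewrite ler_pM2l// lef_pV2 ?posrE.
Qed.

Lemma g_ndecr b b' s : (0 < b)%N -> (b <= b')%N -> 0 < s -> g b s <= g b' s.
Proof.
move=> b0 bb' s0; rewrite !gE ?(leq_trans b0)// ler_wpM2l//.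
  by rewrite le_max ler01 orbT.
by apply: pois_min_avg_ndecr => //; rewrite invr_ge0 ltW.
Qed.

Lemma g_upper b s : (0 < b)%N -> 0 < s -> g b s <= 1.
Proof.
move=> b0 s0; have b0R : 0 < b%:R :> R by rewrite ltr0n.
have bs0 : 0 < b%:R / s by rewrite divr_gt0.
have [s1|/ltW s1] := leP s 1.
- by rewrite g_le1// ler_pdivrMr// mul1r pois_min_le// ltW.
- by rewrite g_ge1// ler_pdivrMr// mul1r pois_min_le_mean// ltW.
Qed.

Lemma g11 : g 1 1 = 1 - (expR 1)^-1 :> R.
Proof.
rewrite g_le1// !divr1 /pois_min /pois_deficit big_ord1 /pois_cdf big_ord1.
by rewrite /pois expr0 fact0 divr1 mulr1 expRN.
Qed.

Lemma g_diag b : (0 < b)%N -> g b 1 = 1 - pois b%:R b :> R.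
Proof.
move=> b0; have b0R : b%:R != 0 :> R by rewrite pnatr_eq0 -lt0n.
rewrite g_le1// divr1 /pois_min pois_deficit_diag mulrBl divff//.
by rewrite mulrAC divff// mul1r.
Qed.

(** Squeezed between 1 and g(b, 1), which differs from 1 by the Poisson weight at the mode. *)
Lemma cvg_g_b s : 0 < s -> g b s @[b --> \oo] --> (1 : R).
Proof.
move=> s0; apply/cvgrPdist_le => e e0.
have [n n0 ne] : exists2 n : nat, (0 < n)%N & 2 / n%:R <= e.
  exists (Num.bound (2 / e)).+1 => //.
  rewrite ler_pdivrMr ?ltr0n// mulrC -ler_pdivrMr//.
  have /archi_boundP/ltW : 0 <= 2 / e by rewrite divr_ge0// ltW.
  by move=> /le_trans; apply; rewrite ler_nat.
near=> b; have nb : (2 * n ^ 2 <= b)%N by near: b; exact: nbhs_infty_ge.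
have b0 : (0 < b)%N by apply: leq_trans nb; rewrite muln_gt0 expn_gt0 n0.
rewrite ger0_norm ?subr_ge0 ?g_upper//.
apply: le_trans ne; apply: le_trans (@pois_diag_le R _ _ n0 nb).
have := g_ge_g1 b0 s0; rewrite g_diag//; lra.
Unshelve. all: by end_near. Qed.

(** Each weight at k < b with mean b / s is at most (k + 1) s / b <= s. The deficit is thus at most
    b^2 s, and 1 - g at most b s. *)
Lemma cvg_g_0 b : (0 < b)%N -> g b s @[s --> (0 : R)^'+] --> (1 : R).
Proof.
move=> b0; have b0R : 0 < b%:R :> R by rewrite ltr0n.
apply/cvgrPdist_le => e e0; near=> s.
have s0 : 0 < s by near: s; exact: nbhs_right_gt.
have s1 : s <= 1 by near: s; exact: nbhs_right_le.
have se : s <= e / b%:R.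
  by near: s; apply: nbhs_right_le; rewrite divr_gt0.
rewrite ger0_norm ?subr_ge0 ?g_upper// g_le1//.
have bs0 : 0 < b%:R / s by rewrite divr_gt0.
rewrite /pois_min mulrBl divff ?gt_eqF// opprB addrC subrK.
rewrite ler_pdivrMr// pois_deficitE.
apply: (@le_trans _ _ (\sum_(k < b) b%:R * s)); last first.
  rewrite sumr_const card_ord -[leLHS]mulr_natr ler_pM2r//.
  by rewrite mulrC -ler_pdivlMr.
apply: ler_sum => k _.
have kb := ltn_ord k.
have h := @pois_le_inv R (b%:R / s) k bs0.
have kb' : (k : nat)%:R <= b%:R :> R by rewrite ler_nat ltnW.
apply: (@le_trans _ _ (b%:R * pois (b%:R / s) k)).
  by rewrite ler_wpM2r ?gerBl// pois_ge0// ltW.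
rewrite ler_pM2l//; apply: le_trans h _.
rewrite invf_div mulrCA ler_piMr ?(ltW s0)// ler_pdivrMr// mul1r.
by rewrite ler_nat.
Unshelve. all: by end_near. Qed.

(** Here g >= P(X < b) >= P(X = 0) = exp(-b / s) >= 1 - b / s. *)
Lemma cvg_g_pinfty b : (0 < b)%N -> g b s @[s --> +oo] --> (1 : R).
Proof.
move=> b0; have b0R : 0 < b%:R :> R by rewrite ltr0n.
apply/cvgrPdist_le => e e0; near=> s.
have s1 : 1 <= s by near: s; apply: nbhs_pinfty_ge; rewrite num_real.
have s0 : 0 < s by exact: lt_le_trans s1.
have se : b%:R / e <= s by near: s; apply: nbhs_pinfty_ge; rewrite num_real.
rewrite ger0_norm ?subr_ge0 ?g_upper// g_ge1//.
have bs0 : 0 < b%:R / s by rewrite divr_gt0.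
rewrite lerBlDr -lerBlDl ler_pdivlMr//.
apply: le_trans (pois_min_ge b (ltW bs0)); rewrite mulrC ler_pM2l//.
apply: le_trans (pois_cdf_ge_exp b0 (ltW bs0)).
apply: le_trans (expR_ge1Dx _); rewrite lerD2l lerN2.
by rewrite ler_pdivrMr// mulrC -ler_pdivrMr.
Unshelve. all: by end_near. Qed.

End g_properties.

(** * Runs of the algorithm *)

Section samp_run.
Context {R : realType} {I J : finType}.
Variable b : I -> nat.
Implicit Types (n : J -> R -> nat) (a : J * nat) (sel : J * nat -> I).

(** The pathwise part of [is_poisson_process], isolated so that the analysis of a run is
    deterministic. *)
Definition counting_paths n : Prop := forall j,
  [/\ n j 0 = 0%N,
      forall u t, 0 <= u -> u <= t -> t <= 1 -> (n j u <= n j t)%N &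
      forall t, 0 <= t < 1 -> \forall u \near t^'+, n j u = n j t].

Lemma arrival_time_le n a t : 0 <= t <= 1 -> (a.2 < n a.1 t)%N ->
  arrival_time n a <= t.
Proof.
move=> t01 at_; apply: ge_inf; last by [].
by exists 0 => u /= [/andP[]].
Qed.

(** The infimum is attained: by right continuity the count is constant just after it, and times at
    which [a] has arrived accumulate there. *)
Lemma arrived_at_arrival_time n a : counting_paths n -> (a.2 < n a.1 1%R)%N ->
  0 <= arrival_time n a <= 1 /\ (a.2 < n a.1 (arrival_time n a))%N.
Proof.
move=> nP a1.
have [_ nmono nright] := nP a.1.
have t1 : arrival_time n a <= 1 by apply: arrival_time_le; rewrite ?ler01 ?lexx.
have A1 : [set t | 0 <= t <= 1 /\ (a.2 < n a.1 t)%N] 1.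
  by split; rewrite ?ler01 ?lexx.
have t0 : 0 <= arrival_time n a.
  by apply: lb_le_inf; [exists 1|move=> u [/andP[]]].
split; first by rewrite t0.
move: t1; rewrite le_eqVlt => /predU1P[->//|t1].
have : 0 <= arrival_time n a < 1 by rewrite t0.
move=> /nright [e /= e0 He].
have hinf : has_inf [set t | 0 <= t <= 1 /\ (a.2 < n a.1 t)%N].
  by split; [exists 1|exists 0 => u [/andP[]]].
have [u [u01 au] ue] := inf_adherent e0 hinf.
have := arrival_time_le u01 au.
rewrite le_eqVlt => /predU1P[->//|tu].
rewrite -(He u) //=.
rewrite /ball_ /= ltr_distlC; apply/andP; split => //.
by rewrite (lt_le_trans _ (ltW tu))// ltrBlDr ltrDl.
Qed.

Lemma mem_arrivals n a : (a \in arrivals n) = (a.2 < n a.1 1%R)%N.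
Proof.
rewrite mem_sort; case: a => j k /=; apply/allpairsPdep/idP => /=.
  by move=> [j' [k' [_ + [-> ->]]]]; rewrite mem_iota add0n.
by move=> kn; exists j, k; rewrite mem_enum mem_iota add0n.
Qed.

Lemma arrivals_uniq n : uniq (arrivals n).
Proof.
rewrite sort_uniq; apply: allpairs_uniq_dep.
- exact: enum_uniq.
- by move=> j _; exact: iota_uniq.
- by move=> [j k] [j' k'] _ _ /= [-> ->].
Qed.

Lemma arrivals_chronological n s1 a s2 a' : arrivals n = s1 ++ a :: s2 ->
  a' \in s1 -> arrival_time n a' <= arrival_time n a.
Proof.
move=> e a's1.
have tr : transitive (fun a a' : J * nat => arrival_time n a <= arrival_time n a').
  by move=> y x z; exact: le_trans.
have : sorted (fun a a' : J * nat => arrival_time n a <= arrival_time n a') (arrivals n).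
  by apply: sort_sorted => x y; exact: le_total.
rewrite (sorted_pairwise tr) e pairwise_cat => /andP[/allrelP h _].
by apply: h => //; rewrite mem_head.
Qed.

(** Truncated subtraction absorbs rejections: a request for an exhausted agent leaves 0, so all
    requests may be counted, served or not. *)
Lemma capacity_samp sel s i :
  (foldl (samp_step sel) (b, fun=> None) s).1 i =
  (b i - count (fun a => sel a == i) s)%N.
Proof.
elim/last_ind: s => [|s a IH] /=; first by rewrite subn0.
rewrite foldl_rcons -cats1 count_cat /= addn0.
case: (foldl _ _ s) IH => c m /= IH.
rewrite /samp_step; case: ifPn => [c0|] /=.
  rewrite eq_sym; case: eqP => [_|_]; last by rewrite addn0.
  by rewrite IH subnDA subn1.
rewrite -leqNgt leqn0 => /eqP c0.
case: eqP => [si|_]; last by rewrite addn0.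
by rewrite subnDA -IH -si c0.
Qed.

Lemma assignment_samp_cat sel s st a : a \notin s ->
  (foldl (samp_step sel) st s).2 a = st.2 a.
Proof.
elim: s st => [//|a' s IH] st /=; rewrite inE negb_or => /andP[aa' as_].
rewrite IH//; case: st => c m /=; rewrite /samp_step; case: ifP => //= _.
by rewrite (negbTE aa').
Qed.

Lemma samp_serves n sel s1 a s2 : arrivals n = s1 ++ a :: s2 ->
  (count (fun a' => sel a' == sel a) s1 < b (sel a))%N ->
  samp b n sel a = Some (sel a).
Proof.
move=> e cb; rewrite /samp e foldl_cat /=.
rewrite assignment_samp_cat; last first.
  have := arrivals_uniq n; rewrite e cat_uniq => /and3P[_ _].
  by rewrite cons_uniq => /andP[].
have := capacity_samp sel s1 (sel a).
case: (foldl _ _ s1) => c m /= ->.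
by rewrite /samp_step subn_gt0 cb /= eqxx.
Qed.

(* All the agents processed before [a] have arrived by the arrival time of
   [a], hence by any later time t. *)
Lemma samp_serves_by n sel a t (r : seq (J * nat)) : counting_paths n ->
  0 <= t <= 1 -> (a.2 < n a.1 t)%N ->
  (forall a', a' != a -> (a'.2 < n a'.1 t)%N -> a' \in r) ->
  (count (fun a' => sel a' == sel a) r < b (sel a))%N ->
  samp b n sel a = Some (sel a).
Proof.
move=> nP t01 at_ rP cb; have /andP[t0 t1] := t01.
have a1 : (a.2 < n a.1 1%R)%N.
  by have [_ mono _] := nP a.1; apply: leq_trans at_ _; exact: mono.
have aN : a \in arrivals n by rewrite mem_arrivals.
have [s1 [s2 e]] : exists s1 s2, arrivals n = s1 ++ a :: s2.
  by case/path.splitPr: aN => s1 s2; exists s1, s2.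
apply: (samp_serves e); apply: leq_ltn_trans cb.
have := arrivals_uniq n; rewrite e cat_uniq => /and3P[us1 + _].
rewrite /= negb_or => /andP[as1 _].
rewrite -!size_filter; apply: uniq_leq_size; first exact: filter_uniq.
move=> a'; rewrite !mem_filter => /andP[-> a's1] /=.
have := arrivals_chronological e a's1.
have : a' \in arrivals n by rewrite e mem_cat a's1.
rewrite mem_arrivals => /(arrived_at_arrival_time nP)[/andP[t'0 t'1] at'] tt.
apply: rP; first by apply: contraNneq as1 => <-.
apply: leq_trans at' _.
have [_ mono _] := nP a'.1; apply: mono => //.
exact: le_trans tt (arrival_time_le t01 at_).
Qed.

Lemma count_arrivals n (p : pred (J * nat)) :
  count p (arrivals n) = (\sum_j \sum_(k < n j 1%R) p (j, (k : nat)))%N.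
Proof.
rewrite count_sort -sum1_count big_mkcond big_allpairs_dep /= big_enum /=.
apply: eq_bigr => j _.
rewrite -(big_mkord xpredT (fun k => nat_of_bool (p (j, k)))) /index_iota subn0.
by apply: eq_bigr => k _; case: (p _).
Qed.

Lemma servedE n (m : J * nat -> option I) j :
  served n m j = (\sum_(k < n j 1%R) isSome (m (j, (k : nat))))%N.
Proof.
rewrite /served count_arrivals (bigD1 j)//= [X in (_ + X)%N]big1 ?addn0.
  by apply: eq_bigr => k _; rewrite eqxx.
by move=> j' /negbTE j'j; rewrite big1// => k _; rewrite j'j.
Qed.

End samp_run.

(** * Thinning through generating polynomials, and Riemann sums *)

Section poisson_thinning.
Context {R : realType}.
Implicit Types (x y p M : R) (b m n K : nat).

(** The generating polynomial of a Bernoulli variable; products describe sums of independent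
    ones. *)
Definition bern_poly p : {poly R} := (1 - p)%:P + p *: 'X.

Lemma coef_bern_polyX p n m :
  (bern_poly p ^+ n)`_m = 'C(n, m)%:R * (p ^+ m * (1 - p) ^+ (n - m)).
Proof.
rewrite /bern_poly exprDn coef_sum.
under eq_bigr => i _ do rewrite coefMn -polyC_exp coefCM exprZn coefZ coefXn.
have [mn|nm] := ltnP m n.+1.
  rewrite (bigD1 (Ordinal mn))//= eqxx mulr1 big1 ?addr0; last first.
    move=> i /eqP im; case: eqP => [mi|]; last by rewrite !mulr0 mul0rn.
    by case: im; apply: val_inj.
  by rewrite -[LHS]mulr_natl; congr (_ * _); exact: mulrC.
rewrite bin_small// mul0r big1// => i _.
by rewrite gtn_eqF ?mulr0 ?mul0rn// (leq_trans (ltn_ord i)).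
Qed.

Lemma coef_bern_polyM p (Q : {poly R}) m :
  (bern_poly p * Q)`_m = (1 - p) * Q`_m + p * (if m is m'.+1 then Q`_m' else 0).
Proof.
rewrite /bern_poly mulrDl coefD coefCM -scalerAl coefZ coefXM.
by case: m.
Qed.

Lemma pois_conv x y m :
  \sum_(k < m.+1) pois x k * pois y (m - k) = pois (x + y) m.
Proof.
rewrite /pois opprD expRD addrC exprDn mulr_suml mulr_sumr.
apply: eq_bigr => k _.
have km : (k <= m)%N by rewrite -ltnS.
rewrite -mulr_natl -(bin_fact km) !natrM.
field.
by rewrite !pnatr_eq0 -!lt0n !fact_gt0 bin_gt0.
Qed.

(** Terms with c < m have no coefficient m; after a shift by m the others form a partial exponential
    series in x (1 - p). *)
Lemma cvg_pois_thinning x p m :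
  (\sum_(c < K) pois x c *: bern_poly p ^+ c)`_m @[K --> \oo] --> pois (x * p) m.
Proof.
rewrite -(cvg_shiftn m).
have H K : (\sum_(c < K + m) pois x c *: bern_poly p ^+ c)`_m =
    (expR (- x) * ((x * p) ^+ m / m`!%:R)) * series (exp_coeff (x * (1 - p))) K.
  rewrite coef_sum /series /= mulr_sumr.
  rewrite -(big_mkord xpredT (fun c => (pois x c *: bern_poly p ^+ c)`_m)).
  rewrite (big_cat_nat _ (leq_addl K m))//= big_nat big1 ?add0r; last first.
    by move=> c /andP[_ cm]; rewrite coefZ coef_bern_polyX bin_small// mul0r mulr0.
  rewrite -{1}[m]add0n big_addn addnK.
  apply: eq_bigr => c _.
  by rewrite coefZ coef_bern_polyX pois_thinning_term ?leq_addl// addnK.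
under eq_fun do rewrite H.
have -> : pois (x * p) m = (expR (- x) * ((x * p) ^+ m / m`!%:R)) *
    expR (x * (1 - p)).
  by rewrite mulrAC -expRD /pois; congr (expR _ * _); ring.
by apply: cvgMr; exact: is_cvg_series_exp_coeff.
Qed.

(** The factor c counts the choices of a distinguished point and the exponent c - 1 leaves it out;
    size biasing reduces this to the plain case. *)
Lemma cvg_pois_thinning_biased x p m :
  (\sum_(c < K) (pois x c * c%:R) *: bern_poly p ^+ c.-1)`_m @[K --> \oo]
  --> x * pois (x * p) m.
Proof.
rewrite -cvg_shiftS.
under eq_fun => K.
  rewrite big_ord_recl /= mulr0 scale0r add0r.
  under eq_bigr => c _ do rewrite /bump /= add1n mulrC poisS -scalerA.
  rewrite -scaler_sumr coefZ; over.
by apply: cvgMr; exact: cvg_pois_thinning.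
Qed.

Lemma cvg_sumr (T : Type) (s : seq T) (f : T -> nat -> R) (l : T -> R) :
  (forall t, f t K @[K --> \oo] --> l t) ->
  \sum_(t <- s) f t K @[K --> \oo] --> \sum_(t <- s) l t.
Proof.
move=> fl; elim: s => [|t s IH].
  by under eq_fun do rewrite big_nil; rewrite big_nil; exact: cvg_cst.
under eq_fun do rewrite big_cons.
by rewrite big_cons; apply: cvgD.
Qed.

(** Superposition in the limit: each coefficient of a product is a finite convolution, so limits
    pass through it. *)
Lemma cvg_pois_prod (T : Type) (s : seq T) (Q : T -> nat -> {poly R})
    (x : T -> R) m :
  (forall t m', (Q t K)`_m' @[K --> \oo] --> pois (x t) m') ->
  (\prod_(t <- s) Q t K)`_m @[K --> \oo] --> pois (\sum_(t <- s) x t) m.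
Proof.
move=> cQ; elim: s m => [|t s IH] m.
  under eq_fun do rewrite big_nil coef1.
  by rewrite big_nil pois0; exact: cvg_cst.
under eq_fun do rewrite big_cons coefM.
rewrite big_cons -pois_conv.
apply: cvg_sumr => k; apply: cvgM; [exact: cQ|exact: IH].
Qed.

(* Right Riemann sums of the decreasing function [pois_cdf b], whose integral
   is [pois_min b]. *)
Lemma pois_min_riemann b M n : 0 < M -> (0 < n)%N ->
  pois_min b M / M - n%:R^-1 <=
  n%:R^-1 * \sum_(l < n) pois_cdf b (M * (l.+1%:R / n%:R)).
Proof.
move=> M0 n0; have n0R : 0 < n%:R :> R by rewrite ltr0n.
pose t (l : nat) : R := M * (l%:R / n%:R).
have t0 l : 0 <= t l by rewrite mulr_ge0 ?divr_ge0// ltW.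
(* Concavity bounds each increment by the slope at the left endpoint. *)
have step (l : nat) : pois_min b (t l.+1) - pois_min b (t l) <=
    M / n%:R * pois_cdf b (t l).
  rewrite lerBlDl; apply: le_trans (pois_min_tangent b (t0 l) (t0 l.+1)) _.
  rewrite lerD2l; suff -> : t l.+1 - t l = M / n%:R by [].
  by rewrite /t -natr1; ring.
have : pois_min b M <= M / n%:R * \sum_(l < n) pois_cdf b (t l).
  rewrite mulr_sumr -(big_mkord xpredT (fun l => M / n%:R * pois_cdf b (t l))).
  apply: le_trans (ler_sum_nat (fun l _ => step l)).
  by rewrite telescope_sumr// /t divff ?gt_eqF// mul0r mulr0 mulr1 pois_min0 subr0.
(* Left and right sums differ by the first value minus the last, at most 1; this is the source of
   the error 1 / n. *)
have : \sum_(l < n) pois_cdf b (t l) <= 1 + \sum_(l < n) pois_cdf b (t l.+1).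
  have e : \sum_(l < n) pois_cdf b (t l) + pois_cdf b (t n) =
      pois_cdf b (t 0%N) + \sum_(l < n) pois_cdf b (t l.+1).
    rewrite -(big_mkord xpredT (fun l => pois_cdf b (t l))).
    rewrite -(big_mkord xpredT (fun l => pois_cdf b (t l.+1))).
    by rewrite -big_nat_recr// big_nat_recl.
  have := pois_cdf_ge0 b (t0 n); have := pois_cdf_le1 b (t0 0%N).
  move: e; lra.
set A := \sum_(l < n) _; set B := \sum_(l < n) pois_cdf b (t l.+1).
move=> AB hA.
rewrite lerBlDr -[X in _ + X]mulr1 -mulrDr ler_pdivrMr//.
have -> : n%:R^-1 * (B + 1) * M = M / n%:R * (1 + B) by ring.
by apply: le_trans hA _; rewrite ler_wpM2l// divr_ge0// ltW.
Qed.

End poisson_thinning.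

(** * Independent samples and arrivals *)

Section sample_counts.
Context {d : measure_display} {Omega : measurableType d} {R : realType}.
Variable P : probability Omega R.
Context {A : eqType} {I : eqType}.
Variables (S : A -> Omega -> I) (i : I) (p : A -> R).
Hypothesis mS : forall a, discrete_rv (S a).
Hypothesis pS : forall a, P [set w | S a w = i] = (p a)%:E.
Implicit Types (q r : seq A) (B : A -> bool).

Lemma measurable_pattern r (Q : seq bool -> Prop) :
  measurable [set w | Q [seq S a w == i | a <- r]].
Proof.
elim: r Q => [|a r IH] Q /=.
  have [q|q] := pselect (Q [::]).
    by rewrite (_ : [set _ | _] = setT)//; apply/seteqP; split.
  by rewrite (_ : [set _ | _] = set0)//; apply/seteqP; split.
rewrite (_ : [set _ | _] =
   ([set w | S a w = i] `&` [set w | Q (true :: [seq S a w == i | a <- r])]) `|`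
   ([set w | S a w <> i] `&` [set w | Q (false :: [seq S a w == i | a <- r])])).
  apply: measurableU; apply: measurableI.
  - exact: (measurable_discrete_rv (fun x => x = i) (@mS a)).
  - exact: IH (fun s => Q (true :: s)).
  - exact: (measurable_discrete_rv (fun x => x <> i) (@mS a)).
  - exact: IH (fun s => Q (false :: s)).
apply/seteqP; split=> w /=.
  by case: eqP => [e|e] ?; [left|right].
by move=> [[-> //]|[/eqP/negbTE ->]//]; rewrite eqxx.
Qed.

Lemma measurable_all_pattern q B :
  measurable [set w | all (fun a => (S a w == i) == B a) q].
Proof.
elim: q => [|a q IH] /=.
  by rewrite (_ : [set _ | _] = setT)//; apply/seteqP; split.
rewrite (_ : [set _ | _] = [set w | (S a w == i) == B a] `&`
  [set w | all (fun a => (S a w == i) == B a) q]).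
  apply: measurableI => //.
  exact: (measurable_discrete_rv (fun x => (x == i) == B a) (@mS a)).
by apply/seteqP; split=> w /=; [move/andP|move=> h; apply/andP].
Qed.

(** [H] stands for an event of the arrival process, which has index [None]; distinct agents with
    prescribed outcomes contribute independent factors. *)
Lemma pattern_prob (G : set (set Omega)) H q B :
  mutually_independent P (fun o => if o is Some a then sigma_rv (S a) else G) ->
  G H -> uniq q ->
  P [set w | H w /\ all (fun a => (S a w == i) == B a) q] =
  (P H * (\prod_(a <- q) (if B a then p a else 1 - p a))%:E)%E.
Proof.
move=> indep GH uq.
pose Ev (o : option A) := if o is Some a then
  [set w | (S a w == i) == B a] else H.
have := indep (None :: map Some q) Ev.
rewrite big_cons big_map /= => h.
transitivity (P (\bigcap_(k in [set` None :: [seq Some i | i <- q]]) Ev k)).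
  congr (P _); apply/seteqP; split=> w.
    move=> [Hw /allP allw] [a|] //=.
    by rewrite inE /= (mem_map Some_inj) => /allw.
  move=> h'; split; first by apply: (h' None); rewrite /= mem_head.
  apply/allP => a aq; apply: (h' (Some a)).
  by rewrite /= inE /= (mem_map Some_inj).
rewrite h; last 2 first.
- rewrite /= map_inj_uniq ?uq ?andbT; last by move=> ? ? [].
  by apply/negP => /mapP[].
- move=> [a|] //= _.
  by exists [set x | (x == i) == B a] => //; rewrite setTI.
congr (_ * _)%E; rewrite -prodEFin.
apply: eq_bigr => a _ /=; case: (B a).
  rewrite -pS; congr (P _); apply/seteqP; split=> w /=.
    by move=> /eqP/eqP.
  by move=> ->; rewrite eqxx.
transitivity (P (~` [set w | S a w = i])).
  by congr (P _); apply/seteqP; split=> w /=; rewrite eqbF_neg => /eqP.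
rewrite probability_setC ?pS//.
exact: (measurable_discrete_rv (fun x => x = i) (@mS a)).
Qed.

(** Induction on [r]: its head moves to the prescribed agents with either outcome, which multiplies
    the generating polynomial of the count by one Bernoulli factor. [h] is the probability of
    [H]. *)
Lemma pattern_count_prob H (h : R) r q B m : measurable H ->
  (forall q' B', uniq q' ->
     P [set w | H w /\ all (fun a => (S a w == i) == B' a) q'] =
     (h * \prod_(a <- q') (if B' a then p a else 1 - p a))%:E) ->
  uniq (q ++ r) ->
  P [set w | [/\ H w, all (fun a => (S a w == i) == B a) q &
                 count (fun a => S a w == i) r = m]] =
  (h * \prod_(a <- q) (if B a then p a else 1 - p a) *
   (\prod_(a <- r) bern_poly (p a))`_m)%:E.
Proof.
move=> mH hH; elim: r q B m => [|a r IH] q B m.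
  rewrite cats0 => uq; rewrite big_nil coef1; case: m => [|m] /=.
    rewrite mulr1 -hH//; congr (P _); apply/seteqP; split=> w /=.
      by move=> [].
    by move=> [].
  rewrite mulr0 (_ : [set _ | _] = set0) ?measure0//.
  by apply/seteqP; split=> w //= [].
move=> uqr.
have uaq : uniq ((a :: q) ++ r).
  by rewrite -[_ ++ r]/([:: a] ++ q ++ r)
    -(perm_uniq (permEl (perm_catCA q [:: a] r))).
have aq : a \notin q by move: uaq => /=; rewrite mem_cat negb_or -andbA => /andP[].
pose Bv v a' := if a' == a then v else B a'.
have allBv v (f : A -> bool) : all (fun a' => f a' == Bv v a') (a :: q) =
    (f a == v) && all (fun a' => f a' == B a') q.
  rewrite /= /Bv eqxx; congr andb; apply: eq_in_all => a' a'q.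
  by rewrite (_ : a' == a = false)//; apply: contraNF aq => /eqP <-.
have prodBv v : \prod_(a' <- a :: q) (if Bv v a' then p a' else 1 - p a') =
    (if v then p a else 1 - p a) * \prod_(a' <- q) (if B a' then p a' else 1 - p a').
  rewrite big_cons /Bv eqxx; congr (_ * _).
  rewrite big_seq [RHS]big_seq; apply: eq_bigr => a' a'q.
  by rewrite (_ : a' == a = false)//; apply: contraNF aq => /eqP <-.
pose Ev v m' := [set w | [/\ H w,
  all (fun a' => (S a' w == i) == Bv v a') (a :: q) &
  count (fun a => S a w == i) r = m']].
have mEv v m' : measurable (Ev v m').
  rewrite (_ : Ev v m' = H `&` ([set w | all (fun a' => (S a' w == i) == Bv v a') (a :: q)]
      `&` [set w | count (fun a => S a w == i) r = m'])).
    apply: measurableI => //; apply: measurableI.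
      exact: measurable_all_pattern.
    have := measurable_pattern r (fun s => count id s = m').
    by congr (measurable _); apply/funext => w /=; rewrite count_map.
  by apply/seteqP; split=> w; [move=> []|move=> [? []]].
have Eval v m' : P (Ev v m') =
    (h * \prod_(a' <- a :: q) (if Bv v a' then p a' else 1 - p a') *
     (\prod_(a' <- r) bern_poly (p a'))`_m')%:E := IH (a :: q) (Bv v) m' uaq.
rewrite big_cons.
case: m => [|m].
  transitivity (P (Ev false 0%N)).
    congr (P _); apply/seteqP; split=> w; rewrite /Ev /mkset allBv /=.
      by case: eqP => _ /= [Hw hq]; rewrite ?add1n ?add0n => hc.
    by move=> [Hw /andP[/eqP -> hq] hc].
  rewrite Eval prodBv coef_bern_polyM; congr EFin; ring.
(* The two outcomes of the sample at [a] are disjoint and match the two terms of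
   [coef_bern_polyM]. *)
transitivity (P (Ev true m `|` Ev false m.+1)).
  congr (P _); apply/seteqP; split=> w; rewrite /Ev /setU /mkset !allBv /=.
    by case: eqP => _ /= [Hw hq]; rewrite ?add1n ?add0n => hc;
      [left; split=> //; case: hc|right].
  by move=> [[Hw /andP[/eqP -> hq] <-]|[Hw /andP[/eqP -> hq] hc]].
transitivity (P (Ev true m) + P (Ev false m.+1))%E.
  apply: measureU => //.
  apply/seteqP; split=> w //; rewrite /Ev /setI /mkset !allBv.
  by move=> [[_ /andP[/eqP -> _] _] [_ /andP[]]].
rewrite !Eval -EFinD !prodBv coef_bern_polyM; congr EFin; ring.
Qed.

End sample_counts.

Lemma big_option (R : Type) (idx : R) (op : Monoid.com_law idx) (T : finType)
    (F : option T -> R) :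
  \big[op/idx]_(k : option T) F k = op (F None) (\big[op/idx]_(j : T) F (Some j)).
Proof.
rewrite (bigD1 None)//=; congr (op _ _).
rewrite (reindex_omap Some id); last by case.
by apply: eq_bigl => j; rewrite eqxx.
Qed.

(** * Joint law of the arrival counts *)

Section arrival_counts.
Context {d : measure_display} {Omega : measurableType d} {R : realType}.
Context {J : finType}.
Variables (P : probability Omega R) (lam : J -> R) (N : J -> R -> Omega -> nat).
Hypothesis lam_gt0 : forall j, 0 < lam j.
Hypothesis poissonN : poisson_arrivals lam P N.
Implicit Types (t u : R) (j : J) (c : option J -> nat).

Lemma arrivals_counting_paths w : counting_paths (realization N w).
Proof. by move=> j; have [[_ h _ _] _] := (poissonN.1 j, tt); exact: h. Qed.

Lemma arrivals0 j w : N j 0 w = 0%N.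
Proof. by have [] := arrivals_counting_paths w j. Qed.

Lemma discrete_arrivals j t : 0 <= t <= 1 -> discrete_rv (N j t).
Proof. by have [h _ _ _] := poissonN.1 j; exact: h. Qed.

Lemma arrivals_increment_law j u t : 0 <= u -> u < t -> t <= 1 ->
  forall A : set nat, P [set w | A (N j t w - N j u w)%N] =
                      poisson_prob (lam j * (t - u)) 0 A.
Proof. by have [_ _ h _] := poissonN.1 j; exact: h. Qed.

Lemma arrivals_law j t : 0 < t <= 1 -> forall A : set nat,
  P [set w | A (N j t w)] = poisson_prob (lam j * t) 0 A.
Proof.
move=> /andP[t0 t1] A.
rewrite -[in RHS](subr0 t) -arrivals_increment_law//.
congr (P _); apply/funext => w /=.
by rewrite arrivals0 subn0.
Qed.

Lemma arrivals_pmf j t k : 0 <= t <= 1 ->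
  P [set w | N j t w = k] = (pois (lam j * t) k)%:E.
Proof.
move=> /andP[]; rewrite le_eqVlt => /predU1P[<- _|t0 t1].
  (* The increment law covers positive lengths; at time 0 the count is 0, in agreement with the
     weights of mean 0. *)
  rewrite mulr0 pois0.
  case: k => [|k].
    transitivity (P setT); last exact: probability_setT.
    by congr (P _); apply/seteqP; split=> w //= _; rewrite arrivals0.
  transitivity (P set0); last exact: measure0.
  by congr (P _); apply/seteqP; split=> w //=; rewrite arrivals0.
rewrite (arrivals_law _ (_ : 0 < t <= 1) [set k]) ?t0//.
by rewrite poisson_prob1// mulr_gt0.
Qed.

Lemma arrivals_increments_pmf j u t k l : 0 <= u -> u < t -> t <= 1 ->
  P [set w | N j u w = k /\ N j t w = (k + l)%N] =
  (pois (lam j * u) k * pois (lam j * (t - u)) l)%:E.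
Proof.
move=> u0 ut t1.
have t0 := le_lt_trans u0 ut; have u1 := le_trans (ltW ut) t1.
(* The grid 0, u, t, t, ...: its first two increments are the counts up to u and in (u, t]. *)
pose time (n : nat) : R := if n is n'.+1 then if n' is _.+1 then t else u else 0.
pose Ev (n : nat) : set Omega :=
  if n is 0%N then [set w | (N j u w - N j 0 w)%N = k]
  else [set w | (N j t w - N j u w)%N = l].
have [_ _ _ /(_ time)] := poissonN.1 j.
have mono : {homo time : m n / (m <= n)%N >-> m <= n}.
  by move=> [|[|m]] [|[|n]]//= _; rewrite ?(ltW t0)// ltW.
have time01 n : 0 <= time n <= 1.
  by case: n => [|[|n]] /=; rewrite ?lexx ?ler01 ?u0 ?u1 ?t1 ?(ltW t0).
move=> /(_ mono time01 [:: 0%N; 1%N] Ev erefl).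
have Evin n : n \in [:: 0%N; 1%N] ->
    sigma_rv (fun w => (N j (time n.+1) w - N j (time n) w)%N) (Ev n).
  rewrite !inE => /orP[]/eqP ->.
    by exists [set k] => //; rewrite setTI.
  by exists [set l] => //; rewrite setTI.
move=> /(_ Evin) h.
have Nut w : (N j u w <= N j t w)%N.
  by have [_ m _] := arrivals_counting_paths w j; apply: m => //; exact: ltW.
transitivity (P (\bigcap_(n in [set` [:: 0%N; 1%N]]) Ev n)).
  congr (P _); apply/seteqP; split=> w.
    move=> /= [Nu Nt] n /=; rewrite !inE => /orP[]/eqP -> /=.
      by rewrite arrivals0 subn0.
    by rewrite Nt Nu addKn.
  move=> hw; have := hw 0%N; have := hw 1%N; rewrite /= !inE /=.
  move=> /(_ isT) Nt /(_ isT); rewrite arrivals0 subn0 => Nu.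
  by split => //; rewrite -Nt -Nu subnKC.
rewrite h !big_cons big_nil mule1 EFinM -arrivals_pmf ?u0//; congr (_ * _)%E.
  by congr (P _); apply/funext => w /=; rewrite arrivals0 subn0.
rewrite (arrivals_increment_law j u0 ut t1 [set l]) poisson_prob1//.
by rewrite mulr_gt0// subr_gt0.
Qed.

Section arrival_event.
Variables (j0 : J) (u t : R).
Hypotheses (u0 : 0 <= u) (ut : u < t) (t1 : t <= 1).

(* The counts [c] record the agents of each type up to time [t], the ones of
   type [j0] that arrive after time [u] being recorded apart, at [None]. *)
Definition total_count c j : nat := (c (Some j) + (j == j0) * c None)%N.

Definition arrival_event c : set Omega :=
  [set w | N j0 u w = c (Some j0) /\ forall j, N j t w = total_count c j].

(** Means of the independent Poisson counts: type [j0] is split at time u, the other types run up to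
    t. *)
Definition count_rate (k : option J) : R :=
  if k is Some j then lam j * (if j == j0 then u else t) else lam j0 * (t - u).

(** The constraint on the process of type j alone, so that independence of the types applies to the
    intersection. *)
Definition arrival_event_at c j : set Omega :=
  if j == j0 then [set w | N j u w = c (Some j) /\ N j t w = (c (Some j) + c None)%N]
  else [set w | N j t w = c (Some j)].

Lemma arrival_eventE c : arrival_event c = \bigcap_(j in [set` enum J]) arrival_event_at c j.
Proof.
apply/seteqP; split=> w.
  move=> [hu ht] j _; rewrite /arrival_event_at; case: eqP => [->|/eqP jj0] /=.
    by rewrite hu ht /total_count eqxx mul1n.
  by rewrite ht /total_count (negbTE jj0) mul0n addn0.
move=> h; split.
  have := h j0; rewrite /arrival_event_at eqxx /= mem_enum => /(_ isT).
  by case.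
move=> j; have := h j; rewrite /= mem_enum => /(_ isT).
rewrite /arrival_event_at /total_count; case: eqP => /= [_ [_ ->]|_ ->].
  by rewrite mul1n.
by rewrite mul0n addn0.
Qed.

Lemma sigma_process_event s j k : 0 <= s <= 1 ->
  (sigma_process (N j)) [set w | N j s w = k].
Proof.
move=> s01; apply: sub_gen_smallest; exists s; first by rewrite /= in_itv.
by exists [set k] => //; rewrite setTI.
Qed.

Lemma arrival_event_at_sigma c j : (sigma_process (N j)) (arrival_event_at c j).
Proof.
have t0 := le_lt_trans u0 ut; have u1 := le_trans (ltW ut) t1.
rewrite /arrival_event_at; case: ifP => _.
  apply: (@measurableI _ (g_sigma_algebraType
    (\bigcup_(t in `[0, 1]) sigma_rv (N j t))) [set w | N j u w = _]).
    by apply: sigma_process_event; rewrite u0.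
  by apply: sigma_process_event; rewrite ltW.
by apply: sigma_process_event; rewrite ltW.
Qed.

Lemma arrival_event_sigma c : sigma_arrivals N (arrival_event c).
Proof.
rewrite arrival_eventE.
apply: (@fin_bigcap_measurable _ (g_sigma_algebraType
  (\bigcup_(j in [set: J]) sigma_process (N j)))); first exact: finite_seq.
move=> j _; apply: sub_gen_smallest; exists j => //.
exact: arrival_event_at_sigma.
Qed.

Lemma measurable_arrival_event c : measurable (arrival_event c).
Proof.
have t0 := le_lt_trans u0 ut; have u1 := le_trans (ltW ut) t1.
rewrite arrival_eventE; apply: fin_bigcap_measurable; first exact: finite_seq.
move=> j _; rewrite /arrival_event_at.
have m s k : 0 <= s <= 1 -> measurable [set w | N j s w = k].
  by move=> s01; exact: (measurable_discrete_rv [set k] (discrete_arrivals s01)).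
by case: ifP => _; [apply: measurableI|]; apply: m; rewrite ?u0//= ltW.
Qed.

Lemma arrival_event_prob c :
  P (arrival_event c) = (\prod_(k : option J) pois (count_rate k) (c k))%:E.
Proof.
have t0 := le_lt_trans u0 ut; have u1 := le_trans (ltW ut) t1.
rewrite arrival_eventE poissonN.2 ?enum_uniq//; last first.
  by move=> j _; exact: arrival_event_at_sigma.
rewrite big_enum /= big_option /=.
transitivity (\prod_(j : J) (pois (lam j * (if j == j0 then u else t)) (c (Some j))
   * (if j == j0 then pois (lam j0 * (t - u)) (c None) else 1))%:E)%E.
  apply: eq_bigr => j _; rewrite /arrival_event_at; case: eqP => [->|_].
    by rewrite arrivals_increments_pmf.
  by rewrite mulr1 arrivals_pmf// ltW.
rewrite prodEFin big_split /= -big_mkcond big_pred1_eq.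
by congr EFin; rewrite mulrC.
Qed.

End arrival_event.

End arrival_counts.

(** * Expected number of agents served by SAMP *)

Section expectation_bounds.
Context {d : measure_display} {Omega : measurableType d} {R : realType}.
Variable P : probability Omega R.

(** Nonnegativity, measurability and a finite value travel together, so that sums need no
    integrability argument. *)
Definition has_expectation (f : Omega -> R) (v : R) : Prop :=
  [/\ forall w, 0 <= f w, measurable_fun setT f & ('E_P[f] = v%:E)%E].

Lemma has_expectation_indic (A : set Omega) (v : R) :
  measurable A -> P A = v%:E -> has_expectation \1_A v.
Proof.
move=> mA PA; split; [by []|exact: measurable_indic|].
by rewrite unlock integral_indic// setIT.
Qed.

Lemma has_expectation_sum (T : Type) (r : seq T) (Q : pred T)
    (f : T -> Omega -> R) (v : T -> R) :
  (forall t, Q t -> has_expectation (f t) (v t)) ->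
  has_expectation (fun w => \sum_(t <- r | Q t) f t w) (\sum_(t <- r | Q t) v t).
Proof.
move=> fv; split.
- by move=> w; apply: sumr_ge0 => t Qt; have [+ _ _] := fv t Qt; apply.
- pose f' t := if Q t then f t else cst 0.
  rewrite (_ : (fun w => _) = fun w => \sum_(t <- r) f' t w).
    apply: measurable_sum => t; rewrite /f'; case: ifPn => // Qt.
    by have [] := fv t Qt.
  by apply/funext => w; rewrite big_mkcond; apply: eq_bigr => t _; rewrite /f'; case: ifP.
- rewrite unlock.
  under eq_integral do rewrite -sumEFin big_mkcond.
  rewrite (@ge0_integral_sum _ _ _ P _ measurableT _
    (fun t w => if Q t then (f t w)%:E else 0%E)).
  + rewrite -sumEFin [RHS]big_mkcond; apply: eq_bigr => t _.
    case: ifPn => [Qt|_]; last by rewrite integral0.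
    by have [_ _ <-] := fv t Qt; rewrite unlock.
  + move=> t; case Qt: (Q t) => //; apply/measurable_EFinP.
    by have [] := fv t Qt.
  + by move=> t w _; case: ifPn => // Qt; rewrite lee_fin; have [+ _ _] := fv t Qt; apply.
Qed.

(* No measurability is needed of [f]: the integral of a nonnegative function is
   the supremum of those of the simple functions below it. *)
Lemma has_expectation_le (h : Omega -> R) (v : R) (f : Omega -> R) :
  has_expectation h v -> (forall w, h w <= f w) -> (v%:E <= 'E_P[f])%E.
Proof.
move=> [h0 mh <-] hf; rewrite unlock !ge0_integralTE => [|w|w].
- apply: le_ereal_sup; apply: image_subset => k kh w.
  by apply: le_trans (kh w) _; rewrite lee_fin.
- by rewrite lee_fin (le_trans (h0 w)).
- by rewrite lee_fin.
Qed.

End expectation_bounds.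

Section samp_lower_bound.
Context {d : measure_display} {Omega : measurableType d} {R : realType}.
Context {I J : finType}.
Variables (P : probability Omega R) (E : I -> J -> bool) (b : I -> nat).
Variables (lam : J -> R) (N : J -> R -> Omega -> nat).
Variables (S : J * nat -> Omega -> I) (p : I -> J -> R).
Hypothesis lam_gt0 : forall j, 0 < lam j.
Hypothesis poissonN : poisson_arrivals lam P N.
Hypothesis mS : forall a, discrete_rv (S a).
Hypothesis pS : forall i a, P [set w | S a w = i] = (p i a.1)%:E.
Hypothesis indepS : mutually_independent P (fun o : option (J * nat) =>
  if o is Some a then sigma_rv (S a) else sigma_arrivals N).
Variable j0 : J.
Implicit Types (i : I) (c : option J -> nat) (u t : R) (w : Omega).

Definition agents c : seq (J * nat) :=
  [seq (j, k) | j <- enum J, k <- iota 0 (total_count j0 c j)].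

(** Agents are numbered within their type, so those arriving after u follow the [c (Some j0)]
    earlier ones. *)
Definition target c k : J * nat := (j0, (c (Some j0) + k)%N).

Definition others c k : seq (J * nat) := [seq a <- agents c | a != target c k].

(** If m < b i, the target is certainly served on this event, as [i] gets just m other requests by
    time t. *)
Definition served_event i u t c k m : set Omega :=
  [set w | [/\ arrival_event N j0 u t c w, S (target c k) w = i &
               count (fun a => S a w == i) (others c k) = m]].

Lemma mem_agents c a : (a \in agents c) = (a.2 < total_count j0 c a.1)%N.
Proof.
case: a => j k /=; apply/allpairsPdep/idP => /=.
  by move=> [j' [k' [_ + [-> ->]]]]; rewrite mem_iota add0n.
by move=> kn; exists j, k; rewrite mem_enum mem_iota add0n.
Qed.

Lemma uniq_agents c : uniq (agents c).
Proof.
apply: allpairs_uniq_dep.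
- exact: enum_uniq.
- by move=> j _; exact: iota_uniq.
- by move=> [j k] [j' k'] _ _ /= [-> ->].
Qed.

Lemma bern_poly_neq0 (x : R) : bern_poly x != 0.
Proof.
apply/eqP => /(congr1 (horner^~ 1)); rewrite /bern_poly !hornerE subrK.
by move/eqP; rewrite oner_eq0.
Qed.

(** The factor of the target is put back, the agents are grouped by type, and the factor is
    cancelled, polynomials forming an integral domain. *)
Lemma prod_others i c k : (k < c None)%N ->
  \prod_(a <- others c k) bern_poly (p i a.1) =
  bern_poly (p i j0) ^+ (c None).-1 * \prod_j bern_poly (p i j) ^+ c (Some j).
Proof.
move=> kc; apply: (mulfI (bern_poly_neq0 (p i j0))).
have tA : target c k \in agents c.
  by rewrite mem_agents /= /total_count eqxx mul1n ltn_add2l.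
transitivity (\prod_(a <- agents c) bern_poly (p i a.1)).
  by rewrite [RHS](bigD1_seq (target c k) tA (uniq_agents c))/= /others big_filter.
rewrite big_allpairs_dep /= big_enum /=.
transitivity (\prod_j (bern_poly (p i j) ^+ c (Some j) *
    (if j == j0 then bern_poly (p i j0) ^+ c None else 1))).
  apply: eq_bigr => j _; rewrite big_const_seq count_predT size_iota iter_mulr_1.
  rewrite /total_count exprD; congr (_ * _); case: eqP => [->|_].
    by rewrite mul1n.
  by rewrite mul0n.
rewrite big_split /= -big_mkcond big_pred1_eq mulrC mulrA -exprS prednK//.
exact: leq_ltn_trans kc.
Qed.

Section interval.
Variables (u t : R).
Hypotheses (u0 : 0 <= u) (ut : u < t) (t1 : t <= 1).

Lemma measurable_served_event i c k m : measurable (served_event i u t c k m).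
Proof.
rewrite (_ : served_event _ _ _ _ _ _ = arrival_event N j0 u t c `&`
  ([set w | S (target c k) w = i] `&`
   [set w | count (fun a => S a w == i) (others c k) = m])).
  apply: measurableI; first exact: (measurable_arrival_event poissonN).
  apply: measurableI.
    exact: (measurable_discrete_rv [set i] (@mS (target c k))).
  have := measurable_pattern i mS (others c k) (fun s => count id s = m).
  by congr (measurable _); apply/funext => w /=; rewrite count_map.
by apply/seteqP; split=> w; [move=> []|move=> [? []]].
Qed.

Lemma served_event_prob i c k m : (k < c None)%N ->
  P (served_event i u t c k m) =
  ((\prod_(kappa : option J) pois (count_rate lam j0 u t kappa) (c kappa)) *
   p i j0 * (bern_poly (p i j0) ^+ (c None).-1 *
             \prod_j bern_poly (p i j) ^+ c (Some j))`_m)%:E.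
Proof.
move=> kc; rewrite -(prod_others i kc).
set h := \prod_(kappa : option J) _.
have hH q B : uniq q ->
    P [set w | arrival_event N j0 u t c w /\ all (fun a => (S a w == i) == B a) q] =
    (h * \prod_(a <- q) (if B a then p i a.1 else 1 - p i a.1))%:E.
  move=> uq; rewrite (pattern_prob mS (pS i) B indepS _ uq); last first.
    exact: arrival_event_sigma.
  by rewrite (arrival_event_prob lam_gt0 poissonN)// EFinM.
(* The target alone has a prescribed outcome, namely [i]; the other agents are only counted. *)
have := @pattern_count_prob _ _ _ P _ _ S i (fun a => p i a.1) mS _ h
  (others c k) [:: target c k] xpredT m _ hH.
rewrite big_seq1 /= => <-.
- congr (P _); apply/seteqP; split=> w.
    by move=> [Hw Sw cw]; split => //; rewrite Sw eqxx.
  by move=> [Hw]; rewrite andbT => /eqP/eqP Sw cw; split.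
- exact: (measurable_arrival_event poissonN).
- by rewrite filter_uniq ?uniq_agents// mem_filter eqxx.
Qed.

(** At most one indicator is 1: [i] must be the sampled agent and [m] its number of other requests.
    Then [m < b i] leaves capacity for the target. *)
Lemma served_event_le w c k :
  arrival_event N j0 u t c w -> (k < c None)%N ->
  \sum_(i | E i j0) \sum_(m < b i) \1_(served_event i u t c k m) w <=
  (isSome (samp_algorithm b N S w (target c k)))%:R :> R.
Proof.
move=> Hw kc; set i0 := S (target c k) w.
set C := count (fun a => S a w == i0) (others c k).
have t0 := le_lt_trans u0 ut.
have sum_i0 : \sum_(m < b i0) \1_(served_event i0 u t c k m) w <=
    (isSome (samp_algorithm b N S w (target c k)))%:R :> R.
  have [Cb|bC] := ltnP C (b i0).
    rewrite (_ : samp_algorithm b N S w (target c k) = Some i0) /=; last first.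
      apply: (@samp_serves_by _ _ _ _ _ (fun a => S a w) _ t (others c k)) => //.
      - exact: arrivals_counting_paths poissonN w.
      - by rewrite (ltW t0).
      - have [_ ht] := Hw.
        by rewrite /realization ht /= /total_count eqxx mul1n ltn_add2l.
      - move=> a' a't; have [_ ht] := Hw; rewrite /realization ht => a'2.
        by rewrite mem_filter a't mem_agents.
    rewrite (bigD1 (Ordinal Cb))//= big1 ?addr0 => [|m mC].
      by rewrite indicE lern1 leq_b1.
    rewrite indicE memNset// => -[_ _ Cm].
    by case/eqP: mC; apply: val_inj; rewrite /= -Cm.
  rewrite big1// => m _; rewrite indicE memNset// => -[_ _ Cm].
  by have := ltn_ord m; rewrite -Cm ltnNge bC.
apply: le_trans sum_i0.
rewrite big_mkcond (bigD1 i0)//= [X in _ + X]big1 ?addr0.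
  case: ifP => // _; exact: sumr_ge0.
move=> i ii0; case: ifP => // _; rewrite big1// => m _.
by rewrite indicE memNset// => -[_ Si _]; rewrite -Si eqxx in ii0.
Qed.

(** The outcome determines the counts, so at most one [c] contributes, and none if some count
    reaches the truncation level K. *)
Lemma served_events_le w K :
  \sum_(c : {ffun option J -> 'I_K}) \sum_(k < c None) \sum_(i | E i j0)
    \sum_(m < b i) \1_(served_event i u t (fun x => c x) k m) w <=
  \sum_(N j0 u w <= k < N j0 t w)
    (isSome (samp_algorithm b N S w (j0, k)))%:R :> R.
Proof.
have [[c0 Hc0]|noc] := pselect (exists c0 : {ffun option J -> 'I_K},
    arrival_event N j0 u t (fun x => c0 x) w); last first.
  rewrite big1 => [|c _]; first exact: sumr_ge0.
  rewrite big1// => k _; rewrite big1// => i _; rewrite big1// => m _.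
  by rewrite indicE memNset// => -[Hc _ _]; apply: noc; exists c.
rewrite (bigD1 c0)//= [X in _ + X]big1 ?addr0; last first.
  move=> c cc0; rewrite big1// => k _; rewrite big1// => i _; rewrite big1// => m _.
  rewrite indicE memNset// => -[[Hcu Hct] _ _].
  case/eqP: cc0; apply/ffunP => x; apply: val_inj => /=.
  have [Hu Ht] := Hc0.
  (* The count at u fixes [Some j0], then the count at t fixes [None], and then the other types. *)
  have eS : c (Some j0) = c0 (Some j0) :> nat by rewrite -Hcu.
  have := Ht j0; rewrite Hct /total_count eqxx !mul1n eS => /addnI eN.
  case: x => [j|//].
  by have := Ht j; rewrite Hct /total_count eN => /addIn.
have [Hu Ht] := Hc0.
rewrite Ht Hu /total_count eqxx mul1n -{1}[val (c0 (Some j0))]add0n.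
rewrite big_addn addKn big_mkord.
apply: ler_sum => k _; apply: le_trans (served_event_le Hc0 (ltn_ord k)) _.
by rewrite /target addnC.
Qed.

(** The contribution of [i] to the expectation of the truncated lower bound in
    [served_events_le]. *)
Definition served_value K i : R :=
  \sum_(c : {ffun option J -> 'I_K}) \sum_(k < c None) \sum_(m < b i)
   ((\prod_(kappa : option J) pois (count_rate lam j0 u t kappa) (c kappa)) *
   p i j0 * (bern_poly (p i j0) ^+ (c None).-1 *
             \prod_j bern_poly (p i j) ^+ c (Some j))`_m).

(** Distinguishing the target yields the factor p lam (t - u); the other requests for [i] become
    Poisson, of the full mean up to time t, and must number less than b i. *)
Lemma cvg_served_value i :
  served_value K i @[K --> \oo] -->
  p i j0 * (lam j0 * (t - u)) * pois_cdf (b i) (t * \sum_j lam j * p i j).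
Proof.
(* Distributivity turns the sum over count vectors into a product over components. The one at [None]
   is size-biased, since it offers the c choices of the target. *)
pose G (kappa : option J) (c : nat) : {poly R} := if kappa is Some j then
  pois (lam j * (if j == j0 then u else t)) c *: bern_poly (p i j) ^+ c
  else (pois (lam j0 * (t - u)) c * c%:R) *: bern_poly (p i j0) ^+ c.-1.
have valueE K : served_value K i = p i j0 *
    \sum_(m < b i) (\prod_kappa \sum_(c < K) G kappa c)`_m.
  rewrite /served_value mulr_sumr.
  under [RHS]eq_bigr do rewrite bigA_distr_bigA coef_sum mulr_sumr.
  rewrite exchange_big /=; apply: eq_bigr => c _.
  rewrite sumr_const card_ord -sumrMnl; apply: eq_bigr => m _.
  have -> : \prod_kappa G kappa (c kappa) =
      ((\prod_kappa pois (count_rate lam j0 u t kappa) (c kappa)) * (c None)%:R) *: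
      (bern_poly (p i j0) ^+ (c None).-1 * \prod_j bern_poly (p i j) ^+ c (Some j)).
    by rewrite !big_option /= scaler_prod -scalerAl -scalerAr scalerA mulrAC.
  rewrite coefZ -[LHS]mulr_natr; ring.
have cvgN k : (\sum_(c < K) G None c)`_k @[K --> \oo] -->
    lam j0 * (t - u) * pois (lam j0 * (t - u) * p i j0) k.
  exact: cvg_pois_thinning_biased.
pose x j := lam j * (if j == j0 then u else t) * p i j.
have cvgS m : (\prod_j \sum_(c < K) G (Some j) c)`_m @[K --> \oo] -->
    pois (\sum_j x j) m.
  apply: (@cvg_pois_prod R J (index_enum J)
    (fun j K => \sum_(c < K) G (Some j) c) x) => j m'.
  exact: cvg_pois_thinning.
have mean : lam j0 * (t - u) * p i j0 + \sum_j x j = t * \sum_j lam j * p i j.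
  rewrite (bigD1 j0)//= [in RHS](bigD1 j0)//= /x eqxx [in RHS]mulrDr [in RHS]mulr_sumr addrA.
  congr (_ + _); first by ring.
  by apply: eq_bigr => j /negbTE ->; ring.
have cvgG m : (\prod_kappa \sum_(c < K) G kappa c)`_m @[K --> \oo] -->
    lam j0 * (t - u) * pois (t * \sum_j lam j * p i j) m.
  under eq_fun do rewrite big_option coefM.
  rewrite -mean -pois_conv mulr_sumr.
  apply: (@cvg_sumr R _ (index_enum 'I_m.+1) (fun k K =>
    (\sum_(c < K) G None c)`_k *
    (\prod_j \sum_(c < K) G (Some j) c)`_(m - k))) => k.
  by rewrite mulrA; apply: cvgM; [exact: cvgN|exact: cvgS].
have cvgGs := @cvg_sumr R _ (index_enum 'I_(b i))
  (fun m K => (\prod_kappa \sum_(c < K) G kappa c)`_m) _ cvgG.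
rewrite -mulr_sumr in cvgGs.
rewrite -[X in _ --> X]mulrA.
under eq_fun do rewrite valueE.
by apply: cvgMr; exact: cvgGs.
Qed.

End interval.

Lemma grid_bounds n l : (l < n)%N ->
  [/\ 0 <= l%:R / n%:R :> R, l%:R / n%:R < l.+1%:R / n%:R :> R &
      l.+1%:R / n%:R <= 1 :> R].
Proof.
move=> ln; have n0 : 0 < n%:R :> R by rewrite ltr0n (leq_ltn_trans _ ln).
by rewrite divr_ge0// ltr_pM2r ?invr_gt0// ltr_nat ler_pdivrMr// mul1r ler_nat.
Qed.

(** The intervals tile [0, 1] and their index ranges concatenate, so no served agent is counted
    twice. *)
Lemma served_grid_value n K : (0 < n)%N ->
  ((\sum_(l < n) \sum_(i | E i j0)
      served_value (l%:R / n%:R) (l.+1%:R / n%:R) K i)%:E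
   <= 'E_P[fun w => (served (realization N w) (samp_algorithm b N S w) j0)%:R])%E.
Proof.
move=> n0; have n0R : 0 < n%:R :> R by rewrite ltr0n.
pose F w k : R := (isSome (samp_algorithm b N S w (j0, k)))%:R.
apply: (@has_expectation_le _ _ _ P (fun w => \sum_(l < n)
    \sum_(c : {ffun option J -> 'I_K}) \sum_(k < c None) \sum_(i | E i j0)
    \sum_(m < b i) \1_(served_event i (l%:R / n%:R) (l.+1%:R / n%:R)
                         (fun x => c x) k m) w)).
  rewrite (eq_bigr (fun l : 'I_n => \sum_(c : {ffun option J -> 'I_K})
    \sum_(k < c None) \sum_(i | E i j0) \sum_(m < b i)
      fine (P (served_event i (l%:R / n%:R) (l.+1%:R / n%:R) (fun x => c x) k m)))).
    apply: has_expectation_sum => l _; apply: has_expectation_sum => c _.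
    apply: has_expectation_sum => k _; apply: has_expectation_sum => i _.
    apply: has_expectation_sum => m _.
    have [u0 ut t1] := grid_bounds (ltn_ord l).
    apply: has_expectation_indic; first exact: measurable_served_event.
    by rewrite served_event_prob.
  move=> l _; rewrite /served_value exchange_big /=; apply: eq_bigr => c _.
  rewrite exchange_big /=; apply: eq_bigr => k _; apply: eq_bigr => i _.
  apply: eq_bigr => m _.
  by have [u0 ut t1] := grid_bounds (ltn_ord l); rewrite served_event_prob.
move=> w.
have mono l : (l < n)%N -> (N j0 (l%:R / n%:R) w <= N j0 (l.+1%:R / n%:R) w)%N.
  move=> /grid_bounds[u0 ut t1].
  have [_ h _] := arrivals_counting_paths poissonN w j0.
  by apply: h => //; exact: ltW.
have cat m : (m <= n)%N ->
    \sum_(l < m) \sum_(N j0 (l%:R / n%:R) w <= k < N j0 (l.+1%:R / n%:R) w) F w k =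
    \sum_(0 <= k < N j0 (m%:R / n%:R) w) F w k.
  elim: m => [|m IH] mn.
    by rewrite big_ord0 mul0r (arrivals0 poissonN) big_geq.
  rewrite big_ord_recr /= IH ?(ltnW mn)// -big_cat_nat//.
  exact: mono.
apply: (@le_trans _ _ (\sum_(l < n)
    \sum_(N j0 (l%:R / n%:R) w <= k < N j0 (l.+1%:R / n%:R) w) F w k)).
  apply: ler_sum => l _; have [u0 ut t1] := grid_bounds (ltn_ord l).
  exact: served_events_le.
by rewrite cat// divff ?gt_eqF// big_mkord servedE natr_sum.
Qed.

Lemma cvg_le_ereal (V : nat -> R) (L : R) (x : \bar R) :
  V K @[K --> \oo] --> L -> (forall K, (V K)%:E <= x)%E -> (L%:E <= x)%E.
Proof.
move=> VL; case: x => [r h| _|/(_ 0%N)//]; last by rewrite leey.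
rewrite lee_fin -(cvg_lim _ VL)//.
apply: limr_le; first by apply/cvg_ex; exists L.
by near=> K; rewrite -lee_fin.
Unshelve. all: by end_near. Qed.

(** The truncation level K tends to infinity on a fixed grid, then the grid is refined. An upper
    bound M i on the request rate suffices because P(Pois(m) < b) decreases in m. *)
Lemma samp_served_ge (M : I -> R) :
  (forall i, 0 < M i) -> (forall i, \sum_j lam j * p i j <= M i) ->
  ((\sum_(i | E i j0) p i j0 * lam j0 * (pois_min (b i) (M i) / M i))%:E
   <= 'E_P[fun w => (served (realization N w) (samp_algorithm b N S w) j0)%:R])%E.
Proof.
move=> M0 muM.
have p0 i j : 0 <= p i j by rewrite -lee_fin -(pS i (j, 0%N)) measure_ge0.
have mu0 i : 0 <= \sum_j lam j * p i j.
  by apply: sumr_ge0 => j _; rewrite mulr_ge0// ltW.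
set X := \sum_(i | _) _; set C := \sum_(i | E i j0) p i j0 * lam j0.
(* [harmonic n] is 1 / (n + 1), the Riemann error for n + 1 intervals. *)
apply: (@cvg_le_ereal (fun n => X - C * harmonic n)) => [|n].
  rewrite -[X in _ --> X]subr0 -(mulr0 C).
  apply: cvgB; first exact: cvg_cst.
  by apply: cvgMr; exact: cvg_harmonic.
have n0R : 0 < n.+1%:R :> R by [].
apply: (@le_trans _ _ (\sum_(l < n.+1) \sum_(i | E i j0)
    p i j0 * (lam j0 * (l.+1%:R / n.+1%:R - l%:R / n.+1%:R)) *
    pois_cdf (b i) (l.+1%:R / n.+1%:R * \sum_j lam j * p i j))%:E).
  rewrite lee_fin exchange_big /= /X /C mulr_suml -sumrB.
  apply: ler_sum => i _; rewrite -mulrBr.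
  have := pois_min_riemann (b i) (M0 i) (ltn0Sn n).
  move=> /(ler_wpM2l (mulr_ge0 (p0 i j0) (ltW (lam_gt0 j0)))) /le_trans; apply.
  rewrite mulrA mulr_sumr; apply: ler_sum => l _.
  have -> : p i j0 * (lam j0 * (l.+1%:R / n.+1%:R - l%:R / n.+1%:R)) =
      p i j0 * lam j0 / n.+1%:R.
    by rewrite -mulrBl -natrB// subSnn; ring.
  rewrite ler_wpM2l ?divr_ge0 ?mulr_ge0 ?(ltW (lam_gt0 _))//.
  rewrite pois_cdf_nincr ?mulr_ge0 ?divr_ge0// mulrC.
  by rewrite ler_wpM2r ?divr_ge0.
apply: (@cvg_le_ereal (fun K => \sum_(l < n.+1) \sum_(i | E i j0)
      served_value (l%:R / n.+1%:R) (l.+1%:R / n.+1%:R) K i)) => [|K].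
  apply: (@cvg_sumr R _ (index_enum 'I_n.+1) (fun l K => \sum_(i | E i j0)
    served_value (l%:R / n.+1%:R) (l.+1%:R / n.+1%:R) K i)) => l.
  have cvgl := @cvg_sumr R _ [seq i <- index_enum I | E i j0] (fun i K =>
    served_value (l%:R / n.+1%:R) (l.+1%:R / n.+1%:R) K i) _
    (fun i => @cvg_served_value _ _ i).
  rewrite big_filter in cvgl.
  have -> : (fun K => \sum_(i | E i j0)
      served_value (l%:R / n.+1%:R) (l.+1%:R / n.+1%:R) K i) = (fun K =>
      \sum_(i <- [seq i <- index_enum I | E i j0])
      served_value (l%:R / n.+1%:R) (l.+1%:R / n.+1%:R) K i).
    by apply/funext => K; rewrite big_filter.
  exact: cvgl.
exact: served_grid_value.
Qed.

End samp_lower_bound.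

(** * The clairvoyant optimum *)

Section clairvoyant_bound.
Context {d : measure_display} {Omega : measurableType d} {R : realType}.
Context {I J : finType}.
Variables (P : probability Omega R) (E : I -> J -> bool) (b : I -> nat).
Variables (lam : J -> R) (N : J -> R -> Omega -> nat).
Variable M : Omega -> J * nat -> option I.
Hypothesis lam_gt0 : forall j, 0 < lam j.
Hypothesis poissonN : poisson_arrivals lam P N.
Hypothesis clairvoyantM : clairvoyant E b N M.

Definition assigned i j w : nat :=
  (\sum_(k < N j 1%R w) (M w (j, k : nat) == Some i))%N.

Lemma assigned_capacity i w : (\sum_j assigned i j w <= b i)%N.
Proof.
have [_ h] := clairvoyantM.2 w; have := h i.
by rewrite (count_arrivals (realization N w) (fun a => M w a == Some i)).
Qed.

Lemma assigned_le i j w : (assigned i j w <= b i)%N.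
Proof.
apply: leq_trans (assigned_capacity i w).
by rewrite (bigD1 j)//= leq_addr.
Qed.

Lemma served_assigned j w :
  served (realization N w) (M w) j = (\sum_(i | E i j) assigned i j w)%N.
Proof.
rewrite servedE exchange_big /=; apply: eq_bigr => k _.
have [h _] := clairvoyantM.2 w; have := h (j, k : nat).
case: (M w (j, k : nat)) => [i /(_ i erefl)[_ /= Eij]|_ /=].
  rewrite (bigD1 i)//= eqxx big1 ?addn0// => i' /andP[_ /negbTE i'i].
  by apply/eqP; rewrite eqb0; apply: contraFN i'i => /eqP[->].
by rewrite big1.
Qed.

(** Handles sums with a random number of terms, by a countable partition along the values of [X]. *)
Lemma measurable_random_index (X : Omega -> nat) (f : nat -> Omega -> R) :
  discrete_rv X -> (forall n, measurable_fun setT (f n)) ->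
  measurable_fun setT (fun w => f (X w) w).
Proof.
move=> mX mf _ B mB; rewrite setTI.
rewrite (_ : _ @^-1` B = \bigcup_n ([set w | X w = n] `&` (f n @^-1` B))).
  apply: bigcup_measurable => n _; apply: measurableI.
    exact: (measurable_discrete_rv [set n] mX).
  by have := mf n measurableT B mB; rewrite setTI.
apply/seteqP; split=> w /=.
  by move=> Bw; exists (X w).
by move=> [n _ [<-]].
Qed.

Lemma measurable_assigned i j :
  measurable_fun setT (fun w => (assigned i j w)%:R : R).
Proof.
have mN : discrete_rv (N j 1).
  by apply: (discrete_arrivals poissonN); rewrite ler01 lexx.
pose f n w : R := \sum_(k < n) \1_[set w | M w (j, k : nat) = Some i] w.
rewrite (_ : (fun w => _) = fun w => f (N j 1 w) w).
  apply: measurable_random_index => // n; apply: measurable_sum => k.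
  apply: measurable_indic.
  exact: (measurable_discrete_rv [set Some i] (clairvoyantM.1 (j, k : nat))).
apply/funext => w; rewrite /assigned natr_sum; apply: eq_bigr => k _.
rewrite indicE; case: eqP => h; first by rewrite mem_set.
by rewrite memNset.
Qed.

Lemma expectation_assigned i j :
  exists2 x, 0 <= x & has_expectation P (fun w => (assigned i j w)%:R) x.
Proof.
have ge0 : (0 <= 'E_P[fun w => (assigned i j w)%:R])%E.
  by rewrite unlock; apply: integral_ge0 => w _; rewrite lee_fin.
have le : ('E_P[fun w => (assigned i j w)%:R] <= (b i)%:R%:E)%E.
  rewrite unlock -[leRHS]mule1 -(probability_setT P) -integral_cst//.
  apply: ge0_le_integral => //.
  - by apply/measurable_EFinP; exact: measurable_assigned.
  - by move=> w _; rewrite lee_fin ler_nat assigned_le.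
exists (fine 'E_P[fun w => (assigned i j w)%:R])%E; first exact: fine_ge0.
split => //; first exact: measurable_assigned.
by rewrite fineK// ge0_fin_numE// (le_lt_trans le)// ltry.
Qed.

Lemma clairvoyant_lp : exists x : I -> J -> R,
  [/\ forall i j, 0 <= x i j,
      forall i, \sum_(j | E i j) x i j <= (b i)%:R,
      forall j, \sum_(i | E i j) x i j <= lam j &
      forall j, ('E_P[fun w => (served (realization N w) (M w) j)%:R]
                 = (\sum_(i | E i j) x i j)%:E)%E].
Proof.
pose x i j := sval (cid2 (expectation_assigned i j)).
have x0 i j : 0 <= x i j by rewrite /x; case: cid2.
have Ex i j : has_expectation P (fun w => (assigned i j w)%:R) (x i j).
  by rewrite /x; case: cid2.
have Eserved j : has_expectation P
    (fun w => (served (realization N w) (M w) j)%:R) (\sum_(i | E i j) x i j).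
  rewrite (_ : (fun w => _) = fun w => \sum_(i | E i j) (assigned i j w)%:R).
    exact: has_expectation_sum.
  by apply/funext => w; rewrite served_assigned natr_sum.
exists x; split => //; last by move=> j; have [] := Eserved j.
- move=> i; rewrite -lee_fin.
  have := @has_expectation_le _ _ _ P _ _ (cst (b i)%:R)
    (has_expectation_sum (index_enum J) (fun j (_ : E i j) => Ex i j)).
  rewrite expectation_cst; apply => w /=.
  rewrite -natr_sum ler_nat; apply: leq_trans (assigned_capacity i w).
  by rewrite [leqRHS](bigID (E i)) /= leq_addr.
- move=> j; rewrite -lee_fin.
  (* No more than the total capacity B is ever served, so the arrivals may be capped at B; their
     mean is then a [pois_min], at most lam j. *)
  pose B := (\sum_i b i)%N.
  have mN : discrete_rv (N j 1).
    by apply: (discrete_arrivals poissonN); rewrite ler01 lexx.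
  have lawN A : P [set w | A (N j 1 w)] = poisson_prob (lam j) 0 A.
    by rewrite -[in RHS](mulr1 (lam j)) (arrivals_law poissonN)// ltr01 lexx.
  apply: (@le_trans _ _ 'E_P[fun w => (minn (N j 1 w) B)%:R]%E); last first.
    rewrite (expectation_minn_poisson B mN (lam_gt0 j) lawN) lee_fin.
    exact/pois_min_le_mean/ltW.
  apply: has_expectation_le (Eserved j) _ => w.
  rewrite ler_nat leq_min; apply/andP; split.
    rewrite servedE; apply: leq_trans (_ : \sum_(k < N j 1%R w) 1 <= _)%N.
      by apply: leq_sum => k _; exact: leq_b1.
    by rewrite sum1_card card_ord.
  rewrite served_assigned big_mkcond; apply: leq_sum => i _.
  by case: ifP => // _; exact: assigned_le.
Qed.

(** The expected assignments are LP-feasible with the fairness as value, hence the bound s; serving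
    at most the arrivals gives 1. The type [j1] keeps the minimum below its neutral value +oo. *)
Lemma clairvoyant_le (x : I -> J -> R) (s : R) (j1 : J) :
  lp_optimal E b lam x s ->
  (long_run_fairness lam P N M <= (Num.min s 1)%:E)%E.
Proof.
move=> [_ sopt]; have [y [y0 yb ylam Ey]] := clairvoyant_lp.
rewrite /long_run_fairness.
under eq_bigr do rewrite Ey.
set v := \big[_/_]_j _.
have vle j : (v <= ((\sum_(i | E i j) y i j) / lam j)%:E)%E.
  apply: le_trans (@bigmin_le_cond _ _ _ _ j xpredT _ isT) _.
  by rewrite inver gt_eqF.
have v0 : (0 <= v)%E.
  apply: le_bigmin => // j _.
  by rewrite inver gt_eqF//= -EFinM lee_fin divr_ge0 ?sumr_ge0// ltW.
have vfin : v \is a fin_num.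
  by rewrite ge0_fin_numE// (le_lt_trans (vle j1))// ltry.
rewrite -(fineK vfin) lee_fin le_min; apply/andP; split.
  apply: (sopt y); split => //; last exact: fine_ge0.
  move=> j; rewrite -ler_pdivlMr// -lee_fin fineK//; exact: vle.
rewrite -lee_fin fineK//; apply: le_trans (vle j1) _.
by rewrite lee_fin ler_pdivrMr// mul1r.
Qed.

End clairvoyant_bound.

Lemma bmin_le (I : finType) (b : I -> nat) i : (bmin b <= b i)%N.
Proof.
rewrite /bmin; move: (\max_i b i)%N => m; have := mem_index_enum i.
elim: (index_enum I) => //= j r IH.
rewrite inE big_cons => /predU1P[->|ir]; first exact: geq_minl.
exact: leq_trans (geq_minr _ _) (IH ir).
Qed.

Lemma bmin_gt0 (I : finType) (b : I -> nat) (i : I) :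
  (forall i, 0 < b i)%N -> (0 < bmin b)%N.
Proof.
move=> b0; rewrite /bmin; elim/big_ind: _ => //.
  by rewrite (leq_trans (b0 i))// leq_bigmax.
by move=> m n m0 n0; rewrite leq_min m0.
Qed.

(** * Competitiveness *)

Section main.
Context {R : realType} {I J : finType}.
Variables (E : I -> J -> bool) (b : I -> nat) (lam : J -> R).
Variables (x : I -> J -> R) (s : R).
Hypotheses (b_gt0 : forall i, (0 < b i)%N) (lam_gt0 : forall j, 0 < lam j).
Hypotheses (xopt : lp_optimal E b lam x s) (s0 : 0 < s).

(** Without types the LP value would be unbounded: s + 1 would also be feasible. *)
Lemma lp_optimal_type : exists j : J, True.
Proof.
have [[h1 _ h3 h4] hs] := xopt.
case: (pickP (fun _ : J => true)) => [j _|J0]; first by exists j.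
have : s + 1 <= s.
  apply: (hs x); split => //; first by move=> j; have := J0 j.
  by rewrite addr_ge0.
by rewrite gerDl ler10.
Qed.

Lemma lp_sum_gt0 j : 0 < \sum_(i | E i j) x i j.
Proof.
have [[_ h _ _] _] := xopt; apply: lt_le_trans (h j).
by rewrite mulr_gt0.
Qed.

Lemma rescale_ge0 i j : E i j -> 0 <= rescale E lam x s i j.
Proof.
have [[_ _ _ h] _] := xopt => Eij.
by rewrite mulr_ge0 ?h// divr_ge0 ?(ltW (lp_sum_gt0 _))// mulr_ge0 ?ltW.
Qed.

(** The covering constraint makes the rescaling factor at most 1, so capacities remain respected. *)
Lemma rescale_le i j : E i j -> rescale E lam x s i j <= x i j.
Proof.
have [[_ h1 _ h] _] := xopt => Eij.
by rewrite ler_piMr ?h// ler_pdivrMr ?lp_sum_gt0// mul1r h1.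
Qed.

Lemma sum_rescale j : \sum_(i | E i j) rescale E lam x s i j = s * lam j.
Proof.
by rewrite -mulr_suml mulrC divfK// gt_eqF// lp_sum_gt0.
Qed.

Section algorithm.
Context {d : measure_display} {Omega : measurableType d}.
Variables (P : probability Omega R) (N : J -> R -> Omega -> nat).
Variable S : J * nat -> Omega -> I.
Hypothesis poissonN : poisson_arrivals lam P N.
Hypothesis sampS : samp_samples E lam P x s N S.

(* The eligible samples already have total probability 1. *)
Lemma sample_prob i a : P [set w | S a w = i] =
  (if E i a.1 then rescale E lam x s i a.1 / (s * lam a.1) else 0)%:E.
Proof.
have [mS pS _] := sampS; case: ifPn => Eia; first exact: pS.
pose v k := fine (P [set w | S a w = k]).
have Pv k : P [set w | S a w = k] = (v k)%:E.
  by rewrite fineK// fin_num_measure//; exact: (measurable_discrete_rv [set k] (mS a)).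
have v0 k : 0 <= v k by rewrite -lee_fin -Pv.
have Ev : has_expectation P (fun w => \sum_k \1_[set w | S a w = k] w) (\sum_k v k).
  apply: has_expectation_sum => k _; apply: has_expectation_indic => //.
  exact: (measurable_discrete_rv [set k] (mS a)).
have : \sum_k v k <= 1.
  rewrite -lee_fin -(expectation_cst P 1); apply: has_expectation_le Ev _ => w.
  rewrite (bigD1 (S a w))//= big1 ?addr0 => [|k /eqP kS].
    by rewrite indicE lern1 leq_b1.
  by rewrite indicE memNset// => /esym.
rewrite (bigID (fun k => E k a.1))/= (eq_bigr (fun k =>
  rescale E lam x s k a.1 / (s * lam a.1))) => [|k Ek]; last by rewrite /v pS.
rewrite -mulr_suml sum_rescale divff ?gt_eqF ?mulr_gt0// gerDl => sum0.
rewrite Pv; congr EFin; apply/eqP; rewrite eq_le v0 andbT.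
by apply: le_trans sum0; rewrite (bigD1 i)//= lerDl sumr_ge0.
Qed.

(** Each unit of rescaled flow from i to j yields at least [pois_min (b i) (M i) / b i] served
    agents, a ratio smallest at the minimal capacity; the flows into j add up to s lam j. *)
Lemma samp_fairness_ge :
  ((s * (pois_min (bmin b) ((bmin b)%:R / s) / (bmin b)%:R))%:E
   <= long_run_fairness lam P N (samp_algorithm b N S))%E.
Proof.
pose p i j := if E i j then rescale E lam x s i j / (s * lam j) else 0.
have [[h1 h2 h3 h4] _] := xopt.
have [mS _ indepS] := sampS.
have bR0 i : 0 < (b i)%:R :> R by rewrite ltr0n.
(* Requests reach [i] at a rate equal to its rescaled flow divided by s, and that flow is at most b
   i. *)
pose M i := (b i)%:R / s.
have M0 i : 0 < M i by rewrite divr_gt0.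
have muM i : \sum_j lam j * p i j <= M i.
  rewrite ler_pdivlMr//; apply: le_trans (h1 i).
  rewrite mulr_suml [leRHS]big_mkcond; apply: ler_sum => j _.
  rewrite /p; case: ifP => [Eij|_]; last by rewrite mulr0 mul0r.
  apply: le_trans (rescale_le Eij); rewrite le_eqVlt; apply/orP; left.
  by apply/eqP; field; rewrite !gt_eqF.
rewrite /long_run_fairness; apply: le_bigmin; first by rewrite leey.
move=> j _.
rewrite inver gt_eqF// lee_pdivlMr//.
have := @samp_served_ge _ _ _ _ _ P E b lam N S p lam_gt0 poissonN mS
  (fun i a => sample_prob i a) indepS j M M0 muM.
apply: le_trans; rewrite -EFinM lee_fin mulrAC -sum_rescale mulr_suml.
apply: ler_sum => i Eij; rewrite /p Eij.
have -> : rescale E lam x s i j / (s * lam j) * lam j * (pois_min (b i) (M i) / M i) =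
    rescale E lam x s i j * (pois_min (b i) (M i) / (b i)%:R).
  by rewrite /M; field; rewrite !gt_eqF.
rewrite ler_wpM2l ?rescale_ge0//.
apply: (pois_min_avg_ndecr _ _ (bmin_le b i)); first by rewrite invr_ge0 ltW.
exact: bmin_gt0 i b_gt0.
Qed.

End algorithm.

Lemma clairvoyant_optimum_le :
  (clairvoyant_optimum E b lam <= (Num.min s 1)%:E)%E.
Proof.
have [j _] := lp_optimal_type.
apply: ge_ereal_sup => v.
move=> -[d] -[T] -[P] -[N] -[M] -[poissonN clairM ->].
exact: (clairvoyant_le lam_gt0 poissonN clairM j xopt).
Qed.

(** Witnessed by rejecting every agent, on the given probability space. *)
Lemma clairvoyant_optimum_ge0 d (Omega : measurableType d)
    (P : probability Omega R) (N : J -> R -> Omega -> nat) :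
  poisson_arrivals lam P N -> (0 <= clairvoyant_optimum E b lam)%E.
Proof.
move=> poissonN.
have clair : clairvoyant E b N (fun _ _ => None).
  split=> [a|w].
    move=> _ [B _ <-] /=; rewrite setTI.
    have [h|h] := pselect (B None).
      by rewrite (_ : _ @^-1` _ = setT)//; apply/seteqP; split.
    by rewrite (_ : _ @^-1` _ = set0)//; apply/seteqP; split.
  split=> // i; rewrite (eq_count (a2 := pred0)) ?count_pred0//.
apply: (@le_trans _ _ (long_run_fairness lam P N (fun _ _ => None))); last first.
  apply: ereal_sup_ubound; exists d, Omega, P, N, (fun _ _ => None).
  by split.
apply: le_bigmin => // j _; rewrite inver gt_eqF// mule_ge0//.
  by rewrite unlock; apply: integral_ge0 => w _; rewrite lee_fin.
by rewrite lee_fin invr_ge0 ltW.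
Qed.

End main.

Theorem theorem2 (R : realType) :
  (forall (I J : finType) (E : I -> J -> bool) (b : I -> nat) (lam : J -> R),
     (forall i, (1 <= b i)%N) -> (forall j, 0 < lam j) ->
   forall (x : I -> J -> R) (s : R), lp_optimal E b lam x s -> 0 < s ->
   forall (d : measure_display) (Omega : measurableType d)
     (P : probability Omega R) (N : J -> R -> Omega -> nat)
     (S : J * nat -> Omega -> I),
     poisson_arrivals lam P N -> samp_samples E lam P x s N S ->
     ((g (bmin b) s)%:E
        <= competitiveness E b lam P N (samp_algorithm b N S))%E /\
     ((g (bmin b) s)%:E * clairvoyant_optimum E b lam
        <= long_run_fairness lam P N (samp_algorithm b N S))%E) /\
  ((g 1 1 = 1 - (expR 1)^-1 :> R) /\
   (forall (b : nat) (s : R), (1 <= b)%N -> 0 < s -> g 1 1 <= g b s)) /\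
  (forall s : R, 0 < s ->
     (forall b : nat, (1 <= b)%N -> g 1 s <= g b s) /\
     (g b s @[b --> \oo] --> (1 : R))) /\
  (forall b : nat, (1 < b)%N ->
     (forall s : R, 0 < s -> g b 1 <= g b s) /\
     (g b s @[s --> (0 : R)^'+] --> (1 : R)) /\
     (g b s @[s --> +oo] --> (1 : R))).
Proof.
split; [|split; [|split]].
- move=> I J E b lam b0 lam0 x s xopt s0 d Omega P N S poissonN sampS.
  set L := long_run_fairness _ _ _ _; set C := clairvoyant_optimum _ _ _.
  have [j _] := lp_optimal_type xopt.
  (* The LP serves each type at a positive rate, which requires an offline agent. *)
  have [i _] : exists i : I, True.
    case: (pickP (fun _ : I => true)) => [i _|I0]; first by exists i.
    by have := lp_sum_gt0 lam0 xopt s0 j; rewrite big_pred0 ?ltxx// => i; have := I0 i.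
  have bm0 : (0 < bmin b)%N by exact: bmin_gt0 i b0.
  have bmR : 0 < (bmin b)%:R / s by rewrite divr_gt0// ltr0n.
  set h := pois_min (bmin b) ((bmin b)%:R / s) / (bmin b)%:R.
  have h0 : 0 < h by rewrite divr_gt0 ?ltr0n// pois_min_gt0.
  have hL : ((s * h)%:E <= L)%E := samp_fairness_ge b0 lam0 xopt s0 poissonN sampS.
  have Cle : (C <= (Num.min s 1)%:E)%E := clairvoyant_optimum_le lam0 xopt.
  have C0 : (0 <= C)%E := clairvoyant_optimum_ge0 E b lam0 poissonN.
  have Cfin : C \is a fin_num by rewrite ge0_fin_numE// (le_lt_trans Cle)// ltry.
  have gC : ((g (bmin b) s)%:E * C <= L)%E.
    apply: le_trans hL; rewrite gE// -/h -(fineK Cfin) -EFinM lee_fin.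
    have Cm : fine C <= Num.min s 1 by rewrite -lee_fin fineK.
    (* The product of max(s, 1) and min(s, 1) is s; the maximum in g thus compensates the bound
       min(s, 1) on the optimum. *)
    have -> : s * h = Num.max s 1 * h * Num.min s 1.
      rewrite mulrAC; congr (_ * _).
      have [s1|/ltW s1] := leP s 1; first by rewrite mul1r.
      by rewrite mulr1.
    by rewrite ler_wpM2l// mulr_ge0 ?(ltW h0)// le_max (ltW s0).
  split=> //; rewrite /competitiveness -/L -/C.
  (* The inverse of 0 is +oo in the extended reals, so a zero optimum gives the ratio +oo, as L >
     0. *)
  have [C00|Cn0] := eqVneq C 0%E.
    rewrite C00 inve0 gt0_muley ?leey//.
    by apply: lt_le_trans hL; rewrite lte_fin mulr_gt0.
  rewrite -(fineK Cfin) inver fine_eq0// (negbTE Cn0) lee_pdivlMr ?fineK//.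
  by rewrite fine_gt0// lt_neqAle eq_sym Cn0 C0 (le_lt_trans Cle)// ltry.
- split; first exact: g11.
  (* Passing through g(1, s): first s varies at b = 1, then b at fixed s. *)
  move=> b s b0 s0; apply: le_trans (g_ge_g1 (ltn0Sn 0) s0) _.
  exact: g_ndecr.
- move=> s s0; split; last exact: cvg_g_b.
  by move=> b b0; exact: g_ndecr.
- move=> b b1; have b0 := ltnW b1; split; first by move=> s; exact: g_ge_g1.
  by split; [exact: cvg_g_0|exact: cvg_g_pinfty].
Qed.
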